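(* Consider the (general) resource allocation game and suppose that Assumptions 1, 2 and 3 (listed in the context) hold. Let the sequences $x_{ij}(k),\eta_{ij}(k),\psi_{ij}^{il}(k),\xi_{ij}^{pq}(k)$ be generated by Algorithm B of the context with step size $\beta>0$. If $$\beta\le\min\left\{\frac{\mu}{2\left(\sum_{i=1}^N\frac{l_i^2\|L_i\|^2}{n_i}+\gamma_\xi b\right)},\ \frac{\gamma_\psi}{8\mu\max_{i\in\mathcal{I}}\{\|L_i\breve{L}_i\|^2\}},\ \frac{\gamma_\xi}{8\mu\max_{i\in\mathcal{I}}\left\{\frac{\|L_i\|^4\sum_{j=1}^{n_i}l_{ij}^2}{n_i^2}\right\}}\right\},$$ where $$\gamma_\psi=4\max_{i\in\mathcal{I}}\{n_i\|\breve{L}_i\|^2\},\qquad b=n_{\mathrm{sum}}\left(2\|\mathcal{M}^TW_{\mathcal{M}}\|^2+\|W_{\mathcal{M}}\|\right),$$ $$\gamma_\xi=4\left(\max_{i\in\mathcal{I}}\Big\{\frac1{n_i}\Big(\sum_{j=1}^{n_i}l_{ij}^2\Big)\|L_i\|^2\Big\}+2\gamma_\psi\max_{i\in\mathcal{I},\,ij\in\mathcal{V}_i}\left\{\left(2\|\bar C_i^TW_{c_i}\bar I_i\|^2+\|\bar I_i^TW_{c_i}\bar I_i\|\right)l_{ij}^2\right\}\|I_{n_{\mathrm{sum}}^2}-\mathcal{M}\|^2\right),$$ then the collective state $\bm{x}(k)$ converges linearly to the Nash equilibrium $\bm{x}^*$ of the game. Moreover, the equality constraints are satisfied at every iteration: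 $\sum_{j=1}^{n_i}x_{ij}(k)=R_i$ for all $i\in\mathcal{I}$ and all $k\in\mathbb{N}$.
   Context: **Game.** There are $N\ge1$ coalitions, $\mathcal{I}=\{1,\dots,N\}$. Coalition $i$ has agent set $\mathcal{V}_i=\{ij: j=1,\dots,n_i\}$ ($ij$ is the $j$th member of coalition $i$). $n_{\mathrm{sum}}=\sum_i n_i$ and $\mathcal{V}=\mathcal{V}_1\cup\dots\cup\mathcal{V}_N$; agents are always ordered $11,\dots,1n_1,21,\dots,Nn_N$. Agent $ij$ has decision $x_{ij}\in\mathbb{R}$ and local resource $R_{ij}\in\mathbb{R}$; $R_i=\sum_{j=1}^{n_i}R_{ij}$, $\bm{x}_i=[x_{i1},\dots,x_{in_i}]^T$, $\bm{x}=[\bm{x}_1^T,\dots,\bm{x}_N^T]^T\in\mathbb{R}^{n_{\mathrm{sum}}}$, and $\bm{x}_{-i}$ is $\bm{x}$ with the block $\bm{x}_i$ removed. Agent $ij$ has objective $f_{ij}:\mathbb{R}^{n_{\mathrm{sum}}}\to\mathbb{R}$, a function of all decisions $\bm{x}$. Coalition $i$ minimizes $f_i=\sum_{l=1}^{n_i}f_{il}$ over $\bm{x}_i\in\Omega_i=\{\bm{x}_i\in\mathbb{R}^{n_i}:\bm{1}_{n_i}^T\bm{x}_i=R_i\}$. With $\Omega=\prod_i\Omega_i$, a Nash equilibrium (NE) is $\bm{x}^*=(\bm{x}_i^*,\bm{x}_{-i}^* )\in\Omega$ such that for every $i\in\mathcal{I}$, $f_i(\bm{x}_i^*,\bm{x}_{-i}^*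 )\le f_i(\bm{x}_i,\bm{x}_{-i}^* )$ for all $\bm{x}_i\in\Omega_i$. (Assumptions 1 and 2 ensure that the NE exists and is unique.) **Assumption 1.** Each $f_{ij}$ is convex and continuously differentiable, and $\nabla f_{ij}$ is Lipschitz with constant $l_{ij}$. Put $l_i=\sum_{j=1}^{n_i}l_{ij}$. **Assumption 2.** With $\mathcal{P}(\bm{x})=[(\frac{\partial f_1}{\partial\bm{x}_1}(\bm{x}))^T,\dots,(\frac{\partial f_N}{\partial\bm{x}_N}(\bm{x}))^T]^T$, there is a constant $\mu>0$ with $(\bm{a}_1-\bm{a}_2)^T(\mathcal{P}(\bm{a}_1)-\mathcal{P}(\bm{a}_2))\ge\mu\|\bm{a}_1-\bm{a}_2\|^2$ for all $\bm{a}_1,\bm{a}_2\in\mathbb{R}^{n_{\mathrm{sum}}}$. **Assumption 3.** The communication graph $\mathcal{G}(\mathcal{V},\mathcal{E})$ (no self-loops) is undirected and connected, and each induced subgraph $\mathcal{G}_i$ on $\mathcal{V}_i$ is undirected and connected. **Matrices.** $\mathcal{N}_{ij}=\{lm:(lm,ij)\in\mathcal{E}\}$, $\mathcal{N}_{ij}^i=\mathcal{N}_{ij}\cap\mathcal{V}_i$. $L_i\in\mathbb{R}^{n_i\times n_i}$ is the (unweighted) graph Laplacian of $\mathcal{G}_i$; $\breve{L}_i=\mathrm{diag}\{(L_i)_1,\dots,(L_i)_{n_i}\}\in\mathbb{R}^{n_i\times n_i^2}$ is the block-diagonal matrix whose $j$th diagonal block is the $j$th row $(L_i)_j$ of $L_i$.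 $C_i=[c_{ij}^{im}]\in\mathbb{R}^{n_i\times n_i}$ is a fixed doubly stochastic matrix with $c_{ij}^{im}>0$ if $im\in\mathcal{N}_{ij}^i\cup\{ij\}$ and $c_{ij}^{im}=0$ otherwise. $\bar C_i=C_i-\frac{1}{n_i}\bm{1}_{n_i}\bm{1}_{n_i}^T$, $\bar I_i=I_{n_i}-\frac1{n_i}\bm{1}_{n_i}\bm{1}_{n_i}^T$, and $W_{c_i}$ is a symmetric positive definite matrix with $\bar C_i^TW_{c_i}\bar C_i-W_{c_i}=-I_{n_i}$ (it exists because $\bar C_i$ is Schur). $W=[w_{ij}^{pq}]\in\mathbb{R}^{n_{\mathrm{sum}}\times n_{\mathrm{sum}}}$ (row indexed by $ij$, column by $pq$) is a fixed matrix with $w_{ij}^{ij}=0$, $w_{ij}^{pq}>0$ if $(pq,ij)\in\mathcal{E}$ and $w_{ij}^{pq}=0$ otherwise, and $\sum_{pq\in\mathcal{V}}w_{ij}^{pq}+\max_{pq\in\mathcal{V}}w_{ij}^{pq}<1$ for all $ij\in\mathcal{V}$. Put $\bar w_{ij}^{pq}=1-\sum_{lm\in\mathcal{N}_{ij}}w_{ij}^{lm}-w_{ij}^{pq}$, $\bar W=\mathrm{diag}\{\bar w_{11}^{11},\dots,\bar w_{11}^{Nn_N},\bar w_{12}^{11},\dots,\bar w_{12}^{Nn_N},\dots,\bar w_{Nn_N}^{Nn_N}\}$ and $\mathcal{M}=W\otimes I_{n_{\mathrm{sum}}}+\bar W\in\mathbb{R}^{n_{\mathrm{sum}}^2\times n_{\mathrm{sum}}^2}$.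 $W_{\mathcal{M}}$ is a symmetric positive definite matrix with $\mathcal{M}^TW_{\mathcal{M}}\mathcal{M}-W_{\mathcal{M}}=-I_{n_{\mathrm{sum}}^2}$ (it exists because $\mathcal{M}$ is Schur). $\|\cdot\|$ is the Euclidean norm and the induced matrix norm. **Algorithm B.** For all $ij\in\mathcal{V}$, $k\in\mathbb{N}$: $$x_{ij}(k)=x_{ij}(0)-\sum_{im\in\mathcal{N}_{ij}^i}(\eta_{ij}(k)-\eta_{im}(k)),$$ $$\eta_{ij}(k+1)=\eta_{ij}(k)+\beta\sum_{im\in\mathcal{N}_{ij}^i}(\psi_{ij}^{ij}(k)-\psi_{ij}^{im}(k)),$$ $$\psi_{ij}^{il}(k+1)=\sum_{im\in\mathcal{N}_{ij}^i\cup\{ij\}}c_{ij}^{im}\psi_{im}^{il}(k)+\frac{\partial f_{ij}}{\partial x_{il}}(\bm{\xi}_{ij}(k+1))-\frac{\partial f_{ij}}{\partial x_{il}}(\bm{\xi}_{ij}(k)),\quad\forall il\in\mathcal{V}_i,$$ $$\xi_{ij}^{pq}(k+1)=\bar w_{ij}^{pq}\xi_{ij}^{pq}(k)+\sum_{lm\in\mathcal{N}_{ij}}w_{ij}^{lm}\xi_{lm}^{pq}(k)+w_{ij}^{pq}x_{pq}(k),\quad\forall pq\in\mathcal{V},$$ with $x_{ij}(0)=R_{ij}$, $\eta_{ij}(0)=0$, $\psi_{ij}^{il}(0)=\frac{\partial f_{ij}}{\partial x_{il}}(\bm{\xi}_{ij}(0))$, and arbitrary real $\xi_{ij}^{pq}(0)$.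 Here $\bm{\xi}_{ij}=[\xi_{ij}^{11},\dots,\xi_{ij}^{1n_1},\xi_{ij}^{21},\dots,\xi_{ij}^{Nn_N}]^T\in\mathbb{R}^{n_{\mathrm{sum}}}$. **Linear convergence** of $\bm{x}(k)$ to $\bm{x}^*$ means that there are $C>0$ and $q\in(0,1)$ with $\|\bm{x}(k)-\bm{x}^*\|\le Cq^k$ for all $k$. *)

(* Defs.v *)
From HB Require Import structures.
From mathcomp Require Import all_boot all_order all_algebra.
From mathcomp Require Import mxtens.
From mathcomp Require Import all_classical all_reals all_analysis.

Set Implicit Arguments.
Unset Strict Implicit.
Unset Printing Implicit Defensive.

Import Order.TTheory GRing.Theory Num.Theory.
Import numFieldNormedType.Exports.

Local Open Scope classical_set_scope.
Local Open Scope ring_scope.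

(* The N coalitions have sizes n i, and the agents are numbered by
   'I_(nsum n) in the order 11, ..., 1n_1, 21, ..., Nn_N: [agent i j] is the
   number of the j-th member of coalition i.  A vector of R^(nsum n) is thus the
   stacking (\mxcol_i x_i) of its blocks x_i = submxcol x i. *)
Notation nsum n := (\sum_i n i)%N.
Notation agent := tagnat.Rank.

Section EuclideanNorm.
Context {R : realType}.

Definition dot m (u v : 'cV[R]_m) : R := (u^T *m v) 0 0.

(* The library norm on matrices is the sup norm. *)
Definition enorm m (v : 'cV[R]_m) : R := Num.sqrt (dot v v).

Definition opnorm m p (A : 'M[R]_(m, p)) : R :=
  sup [set enorm (A *m v) | v in [set v : 'cV[R]_p | enorm v <= 1]].

Definition posdefmx m (P : 'M[R]_m) : Prop :=
  P^T = P /\ forall v : 'cV[R]_m, v != 0 -> 0 < dot v (P *m v).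

Definition lyapunov_solution m (A P : 'M[R]_m) : Prop :=
  posdefmx P /\ A^T *m P *m A - P = - 1%:M.

Definition linear_convergence m (x : nat -> 'cV[R]_m) (xs : 'cV[R]_m) : Prop :=
  exists C q : R, [/\ 0 < C, 0 < q < 1 &
    forall k, enorm (x k - xs) <= C * q ^+ k].

End EuclideanNorm.

Section Calculus.
Context {R : realType} {m : nat}.
Implicit Type g : 'cV[R]_m -> R.

Definition partial (a : 'I_m) g (x : 'cV[R]_m) : R :=
  'D_(delta_mx a 0 : 'cV[R]_m) g x.

Definition gradient g (x : 'cV[R]_m) : 'cV[R]_m := \col_a partial a g x.

Definition continuously_differentiable g : Prop :=
  (forall x, differentiable g x) /\ continuous (gradient g).

Definition euclidean_lipschitz (l : R) (G : 'cV[R]_m -> 'cV[R]_m) : Prop :=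
  forall x y, enorm (G x - G y) <= l * enorm (x - y).

Definition strongly_monotone (mu : R) (G : 'cV[R]_m -> 'cV[R]_m) : Prop :=
  forall x y, mu * enorm (x - y) ^+ 2 <= dot (x - y) (G x - G y).

End Calculus.

Section Game.
Context {R : realType} {N : nat} {n : 'I_N -> nat}.
Variables (f : 'I_(nsum n) -> 'cV[R]_(nsum n) -> R) (res : 'I_(nsum n) -> R).

Definition coalition_cost (i : 'I_N) (x : 'cV[R]_(nsum n)) : R :=
  \sum_(j < n i) f (agent i j) x.

Definition coalition_resource (i : 'I_N) : R := \sum_(j < n i) res (agent i j).

Definition feasible (i : 'I_N) (y : 'cV[R]_(n i)) : Prop :=
  \sum_(j < n i) y j 0 = coalition_resource i.

(* The profile (y, x_{-i}). *)
Definition deviate (x : 'cV[R]_(nsum n)) (i : 'I_N) (y : 'cV[R]_(n i)) :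
    'cV[R]_(nsum n) :=
  \mxcol_h dfwith (T := fun h => 'cV[R]_(n h)) (submxcol x) i y h.

Definition nash_equilibrium (x : 'cV[R]_(nsum n)) : Prop :=
  (forall i, feasible (submxcol x i)) /\
  (forall i (y : 'cV[R]_(n i)), feasible y ->
     coalition_cost i x <= coalition_cost i (deviate x y)).

Definition pseudo_gradient (x : 'cV[R]_(nsum n)) : 'cV[R]_(nsum n) :=
  \mxcol_i \col_(j < n i) partial (agent i j) (coalition_cost i) x.

End Game.

Section Network.
Context {R : realType} {N : nat} {n : 'I_N -> nat}.
(* [edge a b] : (a, b) is an edge, i.e. a is a neighbour of b. *)
Variable edge : rel 'I_(nsum n).

Definition subedge (i : 'I_N) : rel 'I_(n i) :=
  [rel j m | edge (agent i j) (agent i m)].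

Definition communication_graph : Prop :=
  [/\ irreflexive edge, symmetric edge, forall a b, connect edge a b &
      forall i j m, connect (@subedge i) j m].

Definition laplacian (i : 'I_N) : 'M[R]_(n i) :=
  \matrix_(j, m) ((#|[pred h | subedge h j]| * (j == m))%:R
                  - (subedge m j)%:R).

(* Column (a, m) of the n_i x n_i^2 block-diagonal matrix is the m-th column
   of its a-th block. *)
Definition laplacian_rows (i : 'I_N) : 'M[R]_(n i, n i * n i) :=
  \matrix_(j, c) (if (mxtens_unindex c).1 == j
                  then laplacian i j (mxtens_unindex c).2 else 0).

Definition consensus_weights (i : 'I_N) (C : 'M[R]_(n i)) : Prop :=
  [/\ forall j m, subedge m j || (m == j) -> 0 < C j m,
      forall j m, ~~ (subedge m j || (m == j)) -> C j m = 0,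
      forall j, \sum_m C j m = 1 & forall m, \sum_j C j m = 1].

Definition averaging_mx p : 'M[R]_p := p%:R^-1 *: const_mx 1.
Definition Cbar (i : 'I_N) (C : 'M[R]_(n i)) : 'M[R]_(n i) :=
  C - averaging_mx (n i).
Definition Ibar (i : 'I_N) : 'M[R]_(n i) := 1%:M - averaging_mx (n i).

Variable W : 'M[R]_(nsum n).

(* The weights are nonnegative, so 0 is a neutral default for the maximum;
   likewise for every maximum below. *)
Definition observer_weights : Prop :=
  [/\ forall a, W a a = 0,
      forall a b, edge b a -> 0 < W a b,
      forall a b, ~~ edge b a -> W a b = 0 &
      forall a, \sum_b W a b + \big[Num.max/0]_b W a b < 1].

Definition wbar (a b : 'I_(nsum n)) : R :=
  1 - \sum_(c | edge c a) W a c - W a b.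

Definition Wbar : 'M[R]_(nsum n * nsum n) :=
  diag_mx (\row_c wbar (mxtens_unindex c).1 (mxtens_unindex c).2).

Definition observer_mx : 'M[R]_(nsum n * nsum n) := W *t 1%:M + Wbar.

End Network.

Section StepSize.
Context {R : realType} {N : nat} {n : 'I_N -> nat}.
Variables (edge : rel 'I_(nsum n)) (l : 'I_(nsum n) -> R) (mu : R).
Variables (C Wc : forall i, 'M[R]_(n i)).
Variables (W : 'M[R]_(nsum n)) (WM : 'M[R]_(nsum n * nsum n)).

Local Notation L i := (laplacian edge i).
Local Notation LL i := (laplacian_rows edge i).
Local Notation M := (observer_mx edge W).

Definition lip_sum (i : 'I_N) : R := \sum_(j < n i) l (agent i j).
Definition lip_sqsum (i : 'I_N) : R := \sum_(j < n i) l (agent i j) ^+ 2.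

Definition gamma_psi : R :=
  4 * \big[Num.max/0]_(i < N) ((n i)%:R * opnorm (LL i) ^+ 2).

Definition gamma_b : R :=
  (nsum n)%:R * (2 * opnorm (M^T *m WM) ^+ 2 + opnorm WM).

Definition tracking_gain (i : 'I_N) : R :=
  2 * opnorm ((Cbar (C i))^T *m Wc i *m Ibar i) ^+ 2
  + opnorm ((Ibar i)^T *m Wc i *m Ibar i).

Definition gamma_xi : R :=
  4 * (\big[Num.max/0]_(i < N)
         ((n i)%:R^-1 * lip_sqsum i * opnorm (L i) ^+ 2)
       + 2 * gamma_psi
         * (\big[Num.max/0]_(i < N) \big[Num.max/0]_(j < n i)
              (tracking_gain i * l (agent i j) ^+ 2))
         * opnorm (1%:M - M) ^+ 2).

(* A quotient with zero denominator imposes no constraint.  For positive mu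
   the denominators below are nonnegative, and they all vanish when every
   coalition is a singleton (every L_i is then 0). *)
Definition quotient_bound (num den : R) : \bar R :=
  if den == 0 then +oo%E else (num / den)%:E.

Definition step_bound : \bar R :=
  Order.min
    (quotient_bound mu
       (2 * (\sum_(i < N)
               (lip_sum i ^+ 2 * opnorm (L i) ^+ 2 / (n i)%:R)
             + gamma_xi * gamma_b)))
    (Order.min
       (quotient_bound gamma_psi
          (8 * mu * \big[Num.max/0]_(i < N)
             opnorm ((L i) *m LL i) ^+ 2))
       (quotient_bound gamma_xi
          (8 * mu * \big[Num.max/0]_(i < N)
             (opnorm (L i) ^+ 4 * lip_sqsum i / (n i)%:R ^+ 2)))).

End StepSize.

Section Algorithm.
Context {R : realType} {N : nat} {n : 'I_N -> nat}.
Variables (f : 'I_(nsum n) -> 'cV[R]_(nsum n) -> R) (res : 'I_(nsum n) -> R).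
Variables (edge : rel 'I_(nsum n)) (C : forall i, 'M[R]_(n i)).
Variables (W : 'M[R]_(nsum n)) (beta : R).

(* psi k i j l is psi_{ij}^{il}(k), and xi k a is the vector of the estimates
   held by agent a. *)
Definition algorithm (x eta : nat -> 'cV[R]_(nsum n))
    (psi : nat -> forall i, 'M[R]_(n i))
    (xi : nat -> 'I_(nsum n) -> 'cV[R]_(nsum n)) : Prop :=
  [/\ [/\ forall a, x 0%N a 0 = res a,
          forall a, eta 0%N a 0 = 0 &
          forall i (j l : 'I_(n i)), psi 0%N i j l =
            partial (agent i l) (f (agent i j)) (xi 0%N (agent i j))],
      forall k i (j : 'I_(n i)), x k (agent i j) 0 = x 0%N (agent i j) 0
        - \sum_(m < n i | subedge edge m j)
            (eta k (agent i j) 0 - eta k (agent i m) 0),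
      forall k i (j : 'I_(n i)), eta k.+1 (agent i j) 0 = eta k (agent i j) 0
        + beta * \sum_(m < n i | subedge edge m j) (psi k i j j - psi k i j m),
      forall k i (j l : 'I_(n i)), psi k.+1 i j l =
        \sum_(m < n i | subedge edge m j || (m == j)) C i j m * psi k i m l
        + partial (agent i l) (f (agent i j)) (xi k.+1 (agent i j))
        - partial (agent i l) (f (agent i j)) (xi k (agent i j)) &
      forall k a b, xi k.+1 a b 0 = wbar edge W a b * xi k a b 0
        + \sum_(c | edge c a) W a c * xi k c b 0
        + W a b * x k b 0].

End Algorithm.

(* Main.v *)
(* Stack the agents coalition by coalition and let xs be the zero of the
   centered pseudo-gradient on the feasible set; it exists because a projected
   gradient iteration contracts, and by convexity it is the Nash equilibrium.

   Up to the tracking errors Psi and the estimation errors Z, coalition i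
   performs the preconditioned gradient step x - (beta / n_i) L^2 (df_i/dx_i),
   a gradient step in the metric n_i |(L + J)^-1 (x - xs)|^2, J being the
   averaging matrix.  The cross term between Psi and x - xs has no small factor
   in this energy.  It is removed by a change of variables: Psi(k) is a
   difference of consecutive values of Z' = (1 - Cbar)^-1 (centered gradient
   samples - Psi), so adding beta L D Z' to x, where D is the matrix of Laplacian
   rows, gives a variable that follows the exact preconditioned step.  The
   estimation errors are driven by the increments of x, which are O(beta), and
   Psi is driven by the increments of the estimates.  The three energies, with
   weights 1, a and c, decrease together: the step bound makes each loop of
   this interconnection contract, once one knows that
   n_sum^2 <= 2 |1 - M|^2 b (apply the Lyapunov inequality of M to the constant
   vector) and that mu^2 <= n_sum^2 max (gain_i l_ij^2) or this maximum is 0. *)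

Require Import Defs.
From HB Require Import structures.
From mathcomp Require Import all_boot all_order all_algebra.
From mathcomp Require Import mxtens.
From mathcomp Require Import all_classical all_reals all_analysis.
From mathcomp Require Import ring lra.

Set Implicit Arguments.
Unset Strict Implicit.
Unset Printing Implicit Defensive.

Import Order.TTheory GRing.Theory Num.Theory.
Import numFieldNormedType.Exports.

Local Open Scope classical_set_scope.
Local Open Scope ring_scope.

(** * Euclidean geometry and Lyapunov inequalities *)

Section Euclid.
Context {R : realType}.

Lemma dotE m (u v : 'cV[R]_m) : dot u v = \sum_i u i 0 * v i 0.
Proof. by rewrite /dot mxE; apply: eq_bigr => i _; rewrite mxE. Qed.

Lemma dotC m (u v : 'cV[R]_m) : dot u v = dot v u.
Proof. by rewrite !dotE; apply: eq_bigr => i _; rewrite mulrC. Qed.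

Lemma dotDl m (u v w : 'cV[R]_m) : dot (u + v) w = dot u w + dot v w.
Proof. by rewrite /dot linearD mulmxDl mxE. Qed.

Lemma dotDr m (u v w : 'cV[R]_m) : dot w (u + v) = dot w u + dot w v.
Proof. by rewrite dotC dotDl !(dotC w). Qed.

Lemma dotZl m c (u v : 'cV[R]_m) : dot (c *: u) v = c * dot u v.
Proof. by rewrite /dot linearZ -scalemxAl mxE. Qed.

Lemma dotZr m c (u v : 'cV[R]_m) : dot u (c *: v) = c * dot u v.
Proof. by rewrite dotC dotZl dotC. Qed.

Lemma dotNl m (u v : 'cV[R]_m) : dot (- u) v = - dot u v.
Proof. by rewrite -scaleN1r dotZl mulN1r. Qed.

Lemma dotNr m (u v : 'cV[R]_m) : dot u (- v) = - dot u v.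
Proof. by rewrite dotC dotNl dotC. Qed.

Lemma dot0l m (u : 'cV[R]_m) : dot 0 u = 0.
Proof. by rewrite -(scale0r 0) dotZl mul0r. Qed.

Lemma dot0r m (u : 'cV[R]_m) : dot u 0 = 0.
Proof. by rewrite dotC dot0l. Qed.

Lemma dot_suml m I (r : seq I) (P : pred I) (F : I -> 'cV[R]_m) v :
  dot (\sum_(i <- r | P i) F i) v = \sum_(i <- r | P i) dot (F i) v.
Proof.
apply: (big_morph (fun u => dot u v)) => [u w|]; [exact: dotDl|exact: dot0l].
Qed.

Lemma dot_mul m p (A : 'M[R]_(m, p)) u v : dot u (A *m v) = dot (A^T *m u) v.
Proof. by rewrite /dot trmx_mul trmxK mulmxA. Qed.

Lemma dot_sandwich m p q r (A : 'M[R]_(m, p)) (P : 'M[R]_(m, q)) (B : 'M[R]_(q, r)) u v :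
  dot u (A^T *m P *m B *m v) = dot (A *m u) (P *m (B *m v)).
Proof. by rewrite -!mulmxA dot_mul trmxK. Qed.

Lemma sqD m (u v : 'cV[R]_m) :
  dot (u + v) (u + v) = dot u u + 2 * dot u v + dot v v.
Proof. by rewrite dotDl !dotDr (dotC v u); ring. Qed.

Lemma sqB m (u v : 'cV[R]_m) :
  dot (u - v) (u - v) = dot u u - 2 * dot u v + dot v v.
Proof. by rewrite sqD dotNl !dotNr; ring. Qed.

Lemma sqZ m c (u : 'cV[R]_m) : dot (c *: u) (c *: u) = c ^+ 2 * dot u u.
Proof. by rewrite dotZl dotZr mulrA. Qed.

Lemma sqN m (u : 'cV[R]_m) : dot (- u) (- u) = dot u u.
Proof. by rewrite dotNl dotNr opprK. Qed.

Lemma sq_ge0 m (u : 'cV[R]_m) : 0 <= dot u u.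
Proof. by rewrite dotE sumr_ge0 // => i _; rewrite -expr2 sqr_ge0. Qed.

Lemma sq_eq0 m (u : 'cV[R]_m) : (dot u u == 0) = (u == 0).
Proof.
apply/eqP/eqP => [|->]; last by rewrite dot0l.
rewrite dotE => /eqP; rewrite psumr_eq0 => [/allP u0|i _]; last first.
  by rewrite -expr2 sqr_ge0.
apply/colP => i; rewrite mxE.
by have := u0 i (mem_index_enum i); rewrite /= mulf_eq0 orbb => /eqP.
Qed.

Lemma sq_gt0 m (u : 'cV[R]_m) : (0 < dot u u) = (u != 0).
Proof. by rewrite lt_neqAle sq_ge0 andbT eq_sym sq_eq0. Qed.

Lemma cauchy_sq m (u v : 'cV[R]_m) : dot u v ^+ 2 <= dot u u * dot v v.
Proof.
have [->|v0] := eqVneq v 0; first by rewrite !dot0r expr0n mulr0.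
have vv : 0 < dot v v by rewrite sq_gt0.
have := sq_ge0 (dot v v *: u - dot u v *: v).
rewrite sqB !sqZ dotZl dotZr => H.
have {}H : 0 <= dot v v * (dot u u * dot v v - dot u v ^+ 2).
  by apply: le_trans H _; rewrite le_eqVlt; apply/orP; left; apply/eqP; ring.
by rewrite pmulr_rge0 // subr_ge0 in H.
Qed.

Lemma enorm_ge0 m (u : 'cV[R]_m) : 0 <= enorm u.
Proof. exact: sqrtr_ge0. Qed.

Lemma enorm_sq m (u : 'cV[R]_m) : enorm u ^+ 2 = dot u u.
Proof. by rewrite sqr_sqrtr ?sq_ge0. Qed.

Lemma ler_sq (a b : R) : 0 <= b -> a ^+ 2 <= b ^+ 2 -> a <= b.
Proof.
move=> b0 ab; apply: le_trans (ler_norm a) _.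
by rewrite -(ler_pXn2r (n := 2)) ?nnegrE // real_normK ?num_real.
Qed.

Lemma cauchy_schwarz m (u v : 'cV[R]_m) : dot u v <= enorm u * enorm v.
Proof.
apply: ler_sq; first by rewrite mulr_ge0 ?enorm_ge0.
by rewrite exprMn !enorm_sq cauchy_sq.
Qed.

Lemma enormD m (u v : 'cV[R]_m) : enorm (u + v) <= enorm u + enorm v.
Proof.
apply: ler_sq; first by rewrite addr_ge0 ?enorm_ge0.
have := cauchy_schwarz u v.
by rewrite sqrrD !enorm_sq sqD; lra.
Qed.

Lemma enormZ m c (u : 'cV[R]_m) : enorm (c *: u) = `|c| * enorm u.
Proof. by rewrite /enorm sqZ sqrtrM ?sqr_ge0 // sqrtr_sqr. Qed.

Lemma enormN m (u : 'cV[R]_m) : enorm (- u) = enorm u.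
Proof. by rewrite /enorm sqN. Qed.

Lemma enorm0 m : enorm (0 : 'cV[R]_m) = 0.
Proof. by rewrite /enorm dot0l sqrtr0. Qed.

Lemma enorm_sum m I (r : seq I) (F : I -> 'cV[R]_m) :
  enorm (\sum_(i <- r) F i) <= \sum_(i <- r) enorm (F i).
Proof.
elim/big_rec2: _ => [|i x y _ H]; first by rewrite enorm0.
by apply: le_trans (enormD _ _) _; rewrite lerD2l.
Qed.

Lemma enorm_le_sqrt m (u : 'cV[R]_m) (a b : R) :
  0 <= a -> 0 <= b -> dot u u <= a ^+ 2 * b -> enorm u <= a * Num.sqrt b.
Proof.
move=> a0 b0 H; apply: ler_sq; first by rewrite mulr_ge0 ?sqrtr_ge0.
by rewrite enorm_sq exprMn sqr_sqrtr.
Qed.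

Lemma sqD_le2 m (u v : 'cV[R]_m) :
  dot (u + v) (u + v) <= 2 * dot u u + 2 * dot v v.
Proof. by have := sq_ge0 (u - v); rewrite sqB sqD; lra. Qed.

Lemma sqD_le3 m (u v w : 'cV[R]_m) :
  dot (u + v + w) (u + v + w) <= 3 * (dot u u + dot v v + dot w w).
Proof.
have := sq_ge0 (u - v); have := sq_ge0 (u - w); have := sq_ge0 (v - w).
by rewrite !sqB !sqD dotDl; lra.
Qed.

Lemma cauchy_sum I (r : seq I) (a b : I -> R) :
  (\sum_(i <- r) a i * b i) ^+ 2
  <= (\sum_(i <- r) a i ^+ 2) * \sum_(i <- r) b i ^+ 2.
Proof.
pose u := \col_(i < size r) tnth (in_tuple (map a r)) (cast_ord (esym (size_map a r)) i).
pose v := \col_(i < size r) tnth (in_tuple (map b r)) (cast_ord (esym (size_map b r)) i).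
case: r @u @v => [|i0 r] u v; first by rewrite !big_nil expr0n mul0r.
have ua i : u i 0 = a (nth i0 (i0 :: r) i).
  by rewrite mxE (tnth_nth 0) /= -map_cons (nth_map i0).
have vb i : v i 0 = b (nth i0 (i0 :: r) i).
  by rewrite mxE (tnth_nth 0) /= -map_cons (nth_map i0).
have := cauchy_sq u v; rewrite !dotE !(big_nth i0) !big_mkord.
under eq_bigr do rewrite ua vb; under [in X in _ <= X * _]eq_bigr do rewrite ua.
by under [in X in _ <= _ * X]eq_bigr do rewrite vb.
Qed.

(** Triangle inequality, then Cauchy-Schwarz; this is how sums of squared Lipschitz constants arise
    below. *)
Lemma sq_sum_le m I (r : seq I) (F : I -> 'cV[R]_m) (c s : I -> R) :
  (forall i, 0 <= s i) -> (forall i, dot (F i) (F i) <= c i ^+ 2 * s i) ->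
  dot (\sum_(i <- r) F i) (\sum_(i <- r) F i)
  <= (\sum_(i <- r) c i ^+ 2) * \sum_(i <- r) s i.
Proof.
move=> s0 H; rewrite -enorm_sq.
apply: (@le_trans _ _ ((\sum_(i <- r) `|c i| * Num.sqrt (s i)) ^+ 2)).
  rewrite ler_pXn2r ?nnegrE ?enorm_ge0 //; last first.
    by apply: sumr_ge0 => i _; rewrite mulr_ge0 ?sqrtr_ge0.
  apply: le_trans (enorm_sum _ _) _; apply: ler_sum => i _.
  by apply: enorm_le_sqrt => //; rewrite real_normK ?num_real.
apply: le_trans (cauchy_sum _ _ _) _.
under [X in X * _]eq_bigr do rewrite real_normK ?num_real //.
by under [X in _ * X]eq_bigr do rewrite sqr_sqrtr //.
Qed.

Section Opnorm.
Variables (m p : nat) (A : 'M[R]_(m, p)).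

Let opset := [set enorm (A *m v) | v in [set v : 'cV[R]_p | enorm v <= 1]].

(** [sup] is meaningful only for a nonempty set that is bounded above. The Frobenius norm of [A] is
    an upper bound, by Cauchy-Schwarz on each row. *)
Let opset_bounded : has_sup opset.
Proof.
split; first by exists (enorm (A *m 0)), 0 => //=; rewrite enorm0.
exists (Num.sqrt (\sum_i dot (row i A)^T (row i A)^T)) => _ [v /= v1 <-].
apply: ler_wsqrtr; rewrite dotE; apply: ler_sum => i _.
rewrite -expr2 (_ : (A *m v) i 0 = dot (row i A)^T v); last first.
  by rewrite mxE dotE; apply: eq_bigr => j _; rewrite !mxE.
apply: le_trans (cauchy_sq _ _) _.
rewrite -[leRHS]mulr1 ler_wpM2l ?sq_ge0 // -enorm_sq.
by rewrite expr_le1 ?enorm_ge0.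
Qed.

Lemma opnorm_ge0 : 0 <= opnorm A.
Proof.
have [_ ub] := opset_bounded.
apply: (sup_upper_bound opset_bounded).
by exists 0 => /=; rewrite ?enorm0 // mulmx0 enorm0.
Qed.

Lemma opnorm_le v : enorm (A *m v) <= opnorm A * enorm v.
Proof.
have [->|v0] := eqVneq v 0; first by rewrite mulmx0 !enorm0 mulr0.
have nv : 0 < enorm v by rewrite sqrtr_gt0 sq_gt0.
rewrite -ler_pdivrMr // mulrC.
apply: (sup_upper_bound opset_bounded).
exists ((enorm v)^-1 *: v) => /=.
  by rewrite enormZ ger0_norm ?invr_ge0 ?enorm_ge0 // mulVf ?gt_eqF.
by rewrite -scalemxAr enormZ ger0_norm ?invr_ge0 ?enorm_ge0.
Qed.

Lemma opnorm_sq v : dot (A *m v) (A *m v) <= opnorm A ^+ 2 * dot v v.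
Proof.
rewrite -!enorm_sq -exprMn ler_pXn2r ?nnegrE ?enorm_ge0 ?opnorm_le //.
by rewrite mulr_ge0 ?opnorm_ge0 ?enorm_ge0.
Qed.

Lemma opnorm_le_bound c :
  0 <= c -> (forall v, dot (A *m v) (A *m v) <= c * dot v v) ->
  opnorm A ^+ 2 <= c.
Proof.
move=> c0 H; rewrite -[leRHS]sqr_sqrtr // ler_pXn2r ?nnegrE ?opnorm_ge0 ?sqrtr_ge0 //.
apply: ge_sup; first by exists (enorm (A *m 0)), 0 => //=; rewrite enorm0.
move=> _ [v /= v1 <-]; apply: ler_wsqrtr; apply: le_trans (H v) _.
by rewrite -[leRHS]mulr1 ler_wpM2l // -enorm_sq expr_le1 ?enorm_ge0.
Qed.

End Opnorm.

Lemma opnorm_quad m (A : 'M[R]_m) v : dot v (A *m v) <= opnorm A * dot v v.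
Proof.
apply: le_trans (cauchy_schwarz _ _) _.
by rewrite mulrC -[dot v v]enorm_sq expr2 mulrA ler_wpM2r ?enorm_ge0 ?opnorm_le.
Qed.

End Euclid.

(** * Energy inequalities for z+ = A z + E u *)

Section Lyapunov.
Context {R : realType} {m p : nat}.
Variables (A P : 'M[R]_m) (E : 'M[R]_(m, p)).

(** The gain from the squared input to the energy of z. With [Cbar], [Wc] and [Ibar] it is
    [tracking_gain]; with [observer_mx], [WM] and the identity it is [gamma_b] divided by
    [nsum n]. *)
Definition input_gain : R :=
  2 * opnorm (A^T *m P *m E) ^+ 2 + opnorm (E^T *m P *m E).

Hypothesis AP : lyapunov_solution A P.

Lemma lyapunov_quad z : dot (A *m z) (P *m (A *m z)) = dot z (P *m z) - dot z z.
Proof.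
have [_ H] := AP; have : dot z ((A^T *m P *m A - P) *m z) = - dot z z.
  by rewrite H mulNmx mul1mx dotNr.
by rewrite mulmxBl dotDr dotNr dot_sandwich => /eqP; rewrite subr_eq addrC => /eqP.
Qed.

Lemma lyapunov_sym u v : dot u (P *m v) = dot v (P *m u).
Proof. by have [[Pt _] _] := AP; rewrite dot_mul Pt dotC. Qed.

Lemma lyapunov_ge0 z : 0 <= dot z (P *m z).
Proof.
have [[_ P0] _] := AP; have [->|/P0/ltW //] := eqVneq z 0.
by rewrite dot0l.
Qed.

(** By [lyapunov_quad], the difference of the two sides is the energy of [A *m z]. *)
Lemma lyapunov_ge_sq z : dot z z <= dot z (P *m z).
Proof. by have := lyapunov_ge0 (A *m z); rewrite lyapunov_quad; lra. Qed.

Lemma input_gain_ge0 : 0 <= input_gain.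
Proof. by rewrite addr_ge0 ?opnorm_ge0 // mulr_ge0 ?sqr_ge0. Qed.

Lemma sq_input_gain u : dot (E *m u) (E *m u) <= input_gain * dot u u.
Proof.
apply: le_trans (lyapunov_ge_sq _) _.
have := opnorm_quad (E^T *m P *m E) u.
rewrite dot_sandwich.
have := sqr_ge0 (opnorm (A^T *m P *m E)); have := sq_ge0 u.
rewrite /input_gain; nra.
Qed.

(** Half of the decrease pays for the cross term: with B = A^T P E, |z - 2 B u|^2 >= 0 gives 2 z^T B
    u <= |z|^2 / 2 + 2 |B u|^2. *)
Lemma lyapunov_step z u :
  dot (A *m z + E *m u) (P *m (A *m z + E *m u))
  <= dot z (P *m z) - 2^-1 * dot z z + input_gain * dot u u.
Proof.
rewrite mulmxDr dotDl !dotDr lyapunov_quad (lyapunov_sym (E *m u)).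
rewrite -!dot_sandwich.
set B := A^T *m P *m E.
have h1 := opnorm_quad (E^T *m P *m E) u.
have h2 := opnorm_sq B u; have h3 := sq_ge0 (z - 2 *: (B *m u)).
by move: h3; rewrite sqB sqZ dotZr /input_gain -/B; nra.
Qed.

(** At a fixed point the energies on both sides of [lyapunov_step] cancel. *)
Lemma lyapunov_fixed z u : z = A *m z + E *m u -> dot z z <= 2 * input_gain * dot u u.
Proof. by move=> zE; have := lyapunov_step z u; rewrite -zE; lra. Qed.

(** A vector fixed by [A] keeps its energy, while [lyapunov_quad] lowers it by the square of the
    vector; so the vector is zero. *)
Lemma lyapunov_unit : 1%:M - A \in unitmx.
Proof.
rewrite -unitmx_tr -row_free_unit; apply/row_freeP.
suff H (v : 'cV[R]_m) : (1%:M - A) *m v = 0 -> v = 0.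
  have : row_free (1%:M - A)^T.
    rewrite -kermx_eq0; apply/eqP/row_matrixP => i; rewrite row0.
    apply: trmx_inj; rewrite trmx0; apply: H; apply: trmx_inj.
    rewrite trmx_mul trmxK trmx0; apply/eqP; rewrite -row_mul.
    by rewrite mulmx_ker row0.
  by move/row_freeP.
rewrite mulmxBl mul1mx => /eqP; rewrite subr_eq0 => /eqP vE.
apply/eqP; rewrite -sq_eq0; have := lyapunov_quad v; rewrite -vE.
by move/eqP; rewrite eq_sym addrC -subr_eq0 -addrA subrr addr0 oppr_eq0.
Qed.

End Lyapunov.

(** * One coalition *)

Section Averaging.
Context {R : realType} {m : nat}.
Local Notation J := (averaging_mx m : 'M[R]_m).
Local Notation K := (1%:M - J).

Lemma averaging_mulE p (A : 'M[R]_(m, p)) i j :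
  (J *m A) i j = m%:R^-1 * \sum_k A k j.
Proof.
rewrite !mxE mulr_sumr; apply: eq_bigr => k _.
by rewrite !mxE mulr1.
Qed.

Lemma centered_mulE p (A : 'M[R]_(m, p)) i j :
  (K *m A) i j = A i j - m%:R^-1 * \sum_k A k j.
Proof. by rewrite mulmxBl mul1mx [LHS]mxE [X in _ + X]mxE averaging_mulE. Qed.

Lemma averaging_tr : J^T = J.
Proof. by apply/matrixP => i j; rewrite !mxE. Qed.

Lemma averaging_eq0 (v : 'cV[R]_m) : \sum_i v i 0 = 0 -> J *m v = 0.
Proof.
by move=> v0; apply/matrixP => i j; rewrite averaging_mulE ord1 v0 mulr0 mxE.
Qed.

Lemma averaging_mul_dstoch (C : 'M[R]_m) :
  (forall j, \sum_i C i j = 1) -> J *m C = J.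
Proof. by move=> C1; apply/matrixP => i j; rewrite averaging_mulE C1 !mxE. Qed.

Lemma mul_averaging_dstoch (C : 'M[R]_m) :
  (forall i, \sum_j C i j = 1) -> C *m J = J.
Proof.
move=> C1; apply: trmx_inj; rewrite trmx_mul averaging_tr averaging_mul_dstoch //.
by move=> j; under eq_bigr do rewrite mxE.
Qed.

Hypothesis m_gt0 : (0 < m)%N.

Lemma averaging_idem : J *m J = J.
Proof.
apply: mul_averaging_dstoch => i.
under eq_bigr do rewrite !mxE mulr1.
by rewrite sumr_const card_ord -[LHS]mulr_natr mulVf // pnatr_eq0 -lt0n.
Qed.

Lemma averaging_mul0 : J *m K = 0.
Proof. by rewrite mulmxBr mulmx1 averaging_idem subrr. Qed.

Lemma centered_idem : K *m K = K.
Proof. by rewrite mulmxBl mul1mx averaging_mul0 subr0. Qed.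

Lemma sum_centered (v : 'cV[R]_m) : \sum_i (K *m v) i 0 = 0.
Proof.
under eq_bigr do rewrite centered_mulE.
rewrite big_split /= sumr_const card_ord mulNrn -[(_ * _) *+ _]mulr_natl mulrA.
by rewrite mulfV ?mul1r ?subrr // pnatr_eq0 -lt0n.
Qed.

Lemma centered_eq0 (v : 'cV[R]_m) : (forall i j, v i 0 = v j 0) -> K *m v = 0.
Proof.
move=> vc; apply/colP => i; rewrite centered_mulE mxE.
under eq_bigr do rewrite (vc _ i).
rewrite sumr_const card_ord -[v i 0 *+ m]mulr_natl mulrA mulVf ?mul1r ?subrr //.
by rewrite pnatr_eq0 -lt0n.
Qed.

End Averaging.

(** * Matrices as stacked vectors *)

Section Frobenius.
Context {R : realType}.

Lemma sum_mxtens m p (F : 'I_m -> 'I_p -> R) :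
  \sum_(c < m * p) F (mxtens_unindex c).1 (mxtens_unindex c).2
  = \sum_i \sum_j F i j.
Proof.
rewrite pair_big /= (reindex (@mxtens_unindex m p)) //=.
exists (@mxtens_index m p) => c _; [exact: mxtens_unindexK|exact: mxtens_indexK].
Qed.

Lemma col_mul m p q (A : 'M[R]_(m, p)) (B : 'M[R]_(p, q)) l :
  col l (A *m B) = A *m col l B.
Proof. by rewrite !colE mulmxA. Qed.

Definition frob m p (G : 'M[R]_(m, p)) : R := \sum_j \sum_l G j l ^+ 2.

(** Rows are stacked, in the order that indexes the columns of [laplacian_rows] and the entries of
    [observer_mx]. *)
Definition vec m p (G : 'M[R]_(m, p)) : 'cV[R]_(m * p) :=
  \col_c G (mxtens_unindex c).1 (mxtens_unindex c).2.

Lemma sq_vec m p (G : 'M[R]_(m, p)) : dot (vec G) (vec G) = frob G.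
Proof.
rewrite dotE /frob -sum_mxtens; apply: eq_bigr => c _.
by rewrite mxE expr2.
Qed.

Lemma vecD m p (G H : 'M[R]_(m, p)) : vec (G + H) = vec G + vec H.
Proof. by apply/colP => c; rewrite !mxE. Qed.

Lemma frob_ge0 m p (G : 'M[R]_(m, p)) : 0 <= frob G.
Proof. by rewrite -sq_vec sq_ge0. Qed.

Lemma frob_row m p (G : 'M[R]_(m, p)) :
  frob G = \sum_j dot (row j G)^T (row j G)^T.
Proof.
by apply: eq_bigr => j _; rewrite dotE; apply: eq_bigr => l _; rewrite !mxE expr2.
Qed.

Lemma frob_col m p (G : 'M[R]_(m, p)) : frob G = \sum_l dot (col l G) (col l G).
Proof.
rewrite /frob exchange_big; apply: eq_bigr => l _; rewrite dotE.
by apply: eq_bigr => j _; rewrite !mxE expr2.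
Qed.

Lemma frobB_le m p (G H : 'M[R]_(m, p)) :
  frob (G - H) <= 2 * frob G + 2 * frob H.
Proof.
by rewrite -[frob H]/(frob H) -!sq_vec vecD -[dot (vec H) (vec H)]sqN
   (_ : vec (- H) = - vec H) ?sqD_le2 //; apply/colP => c; rewrite !mxE.
Qed.

Lemma trmx_mul_const1 m p (G : 'M[R]_(m, p)) :
  G^T *m const_mx 1 = \sum_j (row j G)^T :> 'cV_p.
Proof.
apply/colP => l; rewrite mxE summxE; apply: eq_bigr => j _.
by rewrite !mxE mulr1.
Qed.

End Frobenius.

(** Arithmetic-geometric mean inequality, with 3/2 as a rational upper bound for the square root of
    2. *)
Lemma young_bound (R : realType) (x a b q : R) :
  0 <= q -> 0 <= a -> 0 <= b -> x ^+ 2 <= 2 * q ^+ 2 * (a * b) ->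
  - (2 * x) <= 3 / 2 * q * (a + b).
Proof.
move=> q0 a0 b0 H.
suff : `|x| <= 3 / 4 * q * (a + b) by rewrite ler_norml => /andP[]; lra.
apply: ler_sq; first by rewrite !mulr_ge0 ?addr_ge0.
rewrite real_normK ?num_real //; apply: le_trans H _.
have : 0 <= q ^+ 2 * (a - b) ^+ 2 by rewrite mulr_ge0 ?sqr_ge0.
have : 0 <= q ^+ 2 * (a + b) ^+ 2 by rewrite mulr_ge0 ?sqr_ge0.
lra.
Qed.

(* For a coalition of size m: u is the deviation of its decisions from the
   equilibrium, row j of G is the partial gradient of f_j at the estimate held by
   member j minus its value at the equilibrium, psi is the matrix of the trackers
   and Psi its centered part. *)
Section Coalition.
Context {R : realType} {m : nat}.
Variables (L C P : 'M[R]_m) (D : 'M[R]_(m, m * m)) (beta : R).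
Local Notation J := (averaging_mx m : 'M[R]_m).
Local Notation K := (1%:M - J).
Local Notation A := (C - J).
Local Notation B := (invmx (L + J)).
Local Notation one := (const_mx 1 : 'cV[R]_m).
Local Notation tr := (input_gain A P K).

Hypotheses (m_gt0 : (0 < m)%N) (L_sym : L^T = L) (LJ : L *m J = 0).
Hypothesis LJ_unit : L + J \in unitmx.
Hypothesis D_vec : forall G : 'M[R]_m,
  D *m vec G = \col_j \sum_l L j l * G j l.
Hypotheses (C_row : forall j, \sum_l C j l = 1) (C_col : forall l, \sum_j C j l = 1).
Hypothesis AP : lyapunov_solution A P.

Lemma averaging_mulL : J *m L = 0.
Proof. by apply: trmx_inj; rewrite trmx_mul averaging_tr L_sym LJ trmx0. Qed.

Lemma L_centered : L *m K = L.
Proof. by rewrite mulmxBr mulmx1 LJ subr0. Qed.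

(** On centered vectors [L + J] coincides with [L], so its inverse serves as a pseudo-inverse of the
    Laplacian. *)
Lemma invL_mulL (v : 'cV[R]_m) : J *m v = 0 -> B *m (L *m v) = v.
Proof.
move=> Jv; have -> : L *m v = (L + J) *m v by rewrite mulmxDl Jv addr0.
by rewrite mulKmx.
Qed.

Lemma mulL_invL (v : 'cV[R]_m) : J *m v = 0 -> L *m (B *m v) = v.
Proof.
move=> Jv; have E : (L + J) *m (B *m v) = v by rewrite mulKVmx.
have J0 : J *m (B *m v) = 0.
  have : J *m ((L + J) *m (B *m v)) = 0 by rewrite E.
  by rewrite mulmxA mulmxDr averaging_mulL add0r averaging_idem.
by rewrite -[RHS]E mulmxDl J0 addr0.
Qed.

Lemma centered_mulC : K *m C = A.
Proof. by rewrite mulmxBl mul1mx averaging_mul_dstoch. Qed.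

Lemma mulA_centered : A *m K = A.
Proof.
by rewrite mulmxBr mulmx1 mulmxBl mul_averaging_dstoch // averaging_idem // subrr subr0.
Qed.

(** All rows of [J *m psi] are equal, so [D] acts on it as [L] on the common row. *)
Lemma D_averaging (psi : 'M[R]_m) :
  D *m vec (J *m psi) = m%:R^-1 *: (L *m (psi^T *m one)).
Proof.
rewrite D_vec; apply/colP => j; rewrite !mxE mulr_sumr; apply: eq_bigr => l _.
rewrite averaging_mulE mulrCA; congr (_ * (_ * _)).
by rewrite mxE; apply: eq_bigr => k _; rewrite !mxE mulr1.
Qed.

Lemma D_tracker (psi : 'M[R]_m) :
  D *m vec psi = m%:R^-1 *: (L *m (psi^T *m one)) + D *m vec (K *m psi).
Proof.
by rewrite -D_averaging -mulmxDr -vecD -mulmxDl addrCA subrr addr0 mul1mx.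
Qed.

(** The solution Z of (1 - A) Z = K G - Psi, whose increments are the tracking errors. *)
Definition residue (G Psi : 'M[R]_m) : 'M[R]_m :=
  invmx (1%:M - A) *m (K *m G - Psi).

(** After multiplication by 1 - A the claim reads K G' - Psi' = K G - Psi + (1 - A) Psi, where the
    recursion for Psi' cancels the sample increment. *)
Lemma residueB (G G' Psi Psi' : 'M[R]_m) :
  Psi' = A *m Psi + K *m (G' - G) -> residue G' Psi' = residue G Psi + Psi.
Proof.
move=> PE; have U := lyapunov_unit AP.
apply: (can_inj (mulKmx U)); rewrite mulmxDr !mulKVmx // PE.
rewrite (mulmxBr K) (mulmxBl 1%:M A Psi) mul1mx [in RHS]addrA subrK.
by rewrite opprD opprB addrCA [X in _ + X]addrC subrK addrC.
Qed.

Lemma frob_fixed (Z G : 'M[R]_m) :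
  Z = A *m Z + K *m G -> frob Z <= 2 * tr * frob G.
Proof.
move=> ZE; rewrite !frob_col mulr_sumr; apply: ler_sum => l _.
by apply: lyapunov_fixed => //; rewrite {1}ZE linearD /= !col_mul.
Qed.

(** Both (1 - A)^-1 K G and (1 - A)^-1 Psi are fixed points as in [frob_fixed], the second one
    because Psi = K Psi. Kept apart, they can be bounded differently in the energy step. *)
Lemma residue_split (G Psi : 'M[R]_m) : K *m Psi = Psi ->
  exists Z1 Z2, [/\ residue G Psi = Z1 - Z2,
    frob Z1 <= 2 * tr * frob G & frob Z2 <= 2 * tr * frob Psi].
Proof.
move=> KP; have U := lyapunov_unit AP.
have fixN (H : 'M[R]_m) : invmx (1%:M - A) *m H = A *m (invmx (1%:M - A) *m H) + H.
  have := mulKVmx U H; set X := invmx _ *m H.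
  by rewrite mulmxBl mul1mx => /eqP; rewrite subr_eq [in X in _ == X -> _]addrC => /eqP.
exists (invmx (1%:M - A) *m (K *m G)), (invmx (1%:M - A) *m (K *m Psi)).
split; first by rewrite /residue mulmxBr KP.
- exact/frob_fixed/fixN.
- exact/frob_fixed/fixN.
Qed.

(* Adding the residue cancels the effect of the tracking errors: the corrected
   deviation moves by -(beta / m) L^2 h exactly. *)
Definition corrected (u : 'cV[R]_m) (G Psi : 'M[R]_m) : 'cV[R]_m :=
  u + beta *: (L *m (D *m vec (residue G Psi))).

(** The weight [m] cancels the 1/m of the averaged step, so the linear term of the energy step is
    exactly 2 beta u^T h. *)
Definition state_energy (u : 'cV[R]_m) (G Psi : 'M[R]_m) : R :=
  m%:R * dot (B *m corrected u G Psi) (B *m corrected u G Psi).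

Definition tracker_energy (Psi : 'M[R]_m) : R :=
  \sum_l dot (col l Psi) (P *m col l Psi).

Lemma tracker_energy_step (G G' Psi Psi' : 'M[R]_m) :
  Psi' = A *m Psi + K *m (G' - G) ->
  tracker_energy Psi' <= tracker_energy Psi - 2^-1 * frob Psi + tr * frob (G' - G).
Proof.
move=> ->; rewrite !frob_col !mulr_sumr /tracker_energy -sumrB -big_split /=.
apply: ler_sum => l _; rewrite linearD /= !col_mul.
exact: lyapunov_step.
Qed.

Lemma tracker_energy_ge0 Psi : 0 <= tracker_energy Psi.
Proof. by apply: sumr_ge0 => l _; apply: (lyapunov_ge0 AP). Qed.

Lemma tracker_energy_le Psi : tracker_energy Psi <= opnorm P * frob Psi.
Proof.
rewrite frob_col mulr_sumr; apply: ler_sum => l _; exact: opnorm_quad.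
Qed.

Lemma state_energy_ge0 u G Psi : 0 <= state_energy u G Psi.
Proof. by rewrite mulr_ge0 // sq_ge0. Qed.

Lemma state_energy_le u G Psi : K *m Psi = Psi ->
  state_energy u G Psi
  <= m%:R * opnorm B ^+ 2 * (2 + 8 * beta ^+ 2 * opnorm (L *m D) ^+ 2 * tr)
     * (dot u u + frob G + frob Psi).
Proof.
move=> KP; rewrite /state_energy -2!(mulrA m%:R) ler_wpM2l // -[leRHS]mulrA.
apply: le_trans (opnorm_sq _ _) _; rewrite ler_wpM2l ?sqr_ge0 //.
apply: le_trans (sqD_le2 _ _) _; rewrite sqZ mulmxA.
have [Z1 [Z2 [-> h1 h2]]] := residue_split G KP.
have h3 := opnorm_sq (L *m D) (vec (Z1 - Z2)); rewrite sq_vec in h3.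
have h4 := frobB_le Z1 Z2.
have h5 : frob (Z1 - Z2) <= 4 * tr * (frob G + frob Psi) by lra.
have h6 := ler_wpM2l (sqr_ge0 (opnorm (L *m D))) h5.
have h7 := ler_wpM2l (sqr_ge0 beta) (le_trans h3 h6).
have t0 : 0 <= tr by exact: input_gain_ge0.
have u0 := sq_ge0 u; have G0 := frob_ge0 G; have P0 := frob_ge0 Psi.
have := mulr_ge0 (sqr_ge0 beta)
  (mulr_ge0 (sqr_ge0 (opnorm (L *m D))) (mulr_ge0 t0 u0)).
lra.
Qed.

(** By [residueB] and [D_tracker] the corrected deviation e becomes e - (beta/m) L L h. In y = B e,
    where L y = e, this is y - (beta/m) L h, and the square expands into -2 beta e^T h and a term in
    beta^2. The correction contained in e enters only at order beta^2. *)
Lemma state_energy_step u u' G G' psi Psi' h (a b : R) :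
  J *m u = 0 ->
  Psi' = A *m (K *m psi) + K *m (G' - G) ->
  u' = u - beta *: (L *m (D *m vec psi)) ->
  L *m (psi^T *m one) = L *m h ->
  0 <= b -> tr * frob G <= b -> tr * dot h h <= m%:R * b ->
  0 <= a -> m%:R * opnorm D ^+ 2 <= a -> opnorm L ^+ 2 <= a ->
  state_energy u' G' Psi'
  <= state_energy u G (K *m psi) - 2 * beta * dot u h
     + beta ^+ 2 * a * (11 / 2 * b + 3 / 2 * frob (K *m psi)).
Proof.
move=> Ju PE uE Lh b0 Gb hb a0 Da La; set Psi := K *m psi.
have KP : K *m Psi = Psi by rewrite /Psi mulmxA centered_idem.
set e := corrected u G Psi.
have Je : J *m e = 0.
  by rewrite /e /corrected mulmxDr Ju add0r -scalemxAr !mulmxA averaging_mulL !mul0mx scaler0.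
have e'E : corrected u' G' Psi' = e - (beta / m%:R) *: (L *m (L *m h)).
  rewrite /corrected (residueB PE) uE vecD 2!mulmxDr scalerDr /e /corrected -/Psi.
  rewrite (D_tracker psi) mulmxDr scalerDr -scalemxAr scalerA Lh -/Psi.
  set v1 := _ *: (L *m (D *m vec (residue _ _))); set v2 := _ *: (L *m (D *m vec Psi)).
  set v3 := (_ / _) *: _.
  by rewrite [v1 + v2]addrC [LHS]addrA opprD [u + _]addrA subrK addrAC.
have m0 : (m%:R : R) != 0 by rewrite pnatr_eq0 -lt0n.
have mp : 0 < (m%:R : R) by rewrite ltr0n.
have JLh : J *m (L *m h) = 0 by rewrite mulmxA averaging_mulL mul0mx.
rewrite /state_energy e'E -/e mulmxBr -scalemxAr (invL_mulL JLh).
set y := B *m e; have Ly : L *m y = e by exact: mulL_invL.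
rewrite sqB sqZ dotZr dot_mul L_sym Ly.
have -> : dot e h = dot u h + beta * dot (L *m (D *m vec (residue G Psi))) h.
  by rewrite /e /corrected dotDl dotZl.
have [Z1 [Z2 [-> h1 h2]]] := residue_split G KP.
have dZ (Z : 'M[R]_m) : dot (L *m (D *m vec Z)) h ^+ 2
    <= opnorm D ^+ 2 * frob Z * dot (L *m h) (L *m h).
  rewrite dotC dot_mul L_sym; apply: le_trans (cauchy_sq _ _) _.
  by rewrite mulrC ler_wpM2r ?sq_ge0 // -sq_vec opnorm_sq.
have t0 : 0 <= tr by exact: input_gain_ge0.
have hh := sq_ge0 h; have G0 := frob_ge0 G; have P0 := frob_ge0 Psi.
have D0 := sqr_ge0 (opnorm D); have L0 := sqr_ge0 (opnorm L).
(* [hb] bounds [h] only together with the gain. Writing [L] as [L *m K] leaves the centered part of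
   [h], which [sq_input_gain] bounds with that gain. *)
have LK : dot (L *m h) (L *m h) <= a * (m%:R * b).
  rewrite -{1 2}L_centered -mulmxA; apply: le_trans (opnorm_sq _ _) _.
  apply: ler_pM => //; first exact: sq_ge0.
  by apply: le_trans hb; apply: sq_input_gain.
have LL := opnorm_sq L h.
have -> : vec (Z1 - Z2) = vec Z1 - vec Z2 by apply/colP => c; rewrite !mxE.
rewrite 2!mulmxBr dotDl dotNl.
set z1 := dot (L *m (D *m vec Z1)) h; set z2 := dot (L *m (D *m vec Z2)) h.
(* Since m |D|^2 <= a, the square of [z1] is at most 2 a^2 b^2 and that of [z2] at most 2 a^2 b
   |Psi|^2. With [LKm], the coefficient of a b adds up to 3 + 3/2 + 1 = 11/2. *)
have z1b : - (2 * z1) <= 3 / 2 * a * (b + b).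
  apply: young_bound => //; apply: le_trans (dZ Z1) _.
  apply: (@le_trans _ _ (opnorm D ^+ 2 * (2 * b) * (a * (m%:R * b)))).
    apply: ler_pM => //; rewrite ?sq_ge0 ?(mulr_ge0 D0 (frob_ge0 _)) //.
    by rewrite ler_wpM2l //; lra.
  have := ler_wpM2r (mulr_ge0 a0 (mulr_ge0 b0 b0)) Da; lra.
have z2b : - (2 * - z2) <= 3 / 2 * a * (b + frob Psi).
  apply: young_bound => //; rewrite sqrrN; apply: le_trans (dZ Z2) _.
  apply: (@le_trans _ _ (opnorm D ^+ 2 * (2 * tr * frob Psi) * (a * dot h h))).
    apply: ler_pM => //; rewrite ?sq_ge0 ?(mulr_ge0 D0 (frob_ge0 _)) //.
      by rewrite ler_wpM2l.
    by apply: le_trans LL _; rewrite ler_wpM2r.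
  have := ler_wpM2l (mulr_ge0 (mulr_ge0 D0 P0) a0) hb.
  have := ler_wpM2r (mulr_ge0 (mulr_ge0 a0 b0) P0) Da; lra.
have LKm : dot (L *m h) (L *m h) / m%:R <= a * b.
  by rewrite ler_pdivrMr //; lra.
have {}z1b := ler_wpM2l (sqr_ge0 beta) z1b.
have {}z2b := ler_wpM2l (sqr_ge0 beta) z2b.
have {}LKm := ler_wpM2l (sqr_ge0 beta) LKm.
have -> : m%:R * (dot y y - 2 * (beta / m%:R * (dot u h + beta * (z1 - z2)))
    + (beta / m%:R) ^+ 2 * dot (L *m h) (L *m h))
  = m%:R * dot y y - 2 * beta * dot u h + beta ^+ 2 * - (2 * z1) - beta ^+ 2 * - (2 * z2)
    + beta ^+ 2 * (dot (L *m h) (L *m h) / m%:R) by field.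
lra.
Qed.

(** Used with [p] the pseudo-gradient error at the true decisions and [q] the effect of the
    estimation errors; the third part is the disagreement of the trackers. *)
Lemma decision_move_le psi p q : L *m (psi^T *m one) = L *m (p + q) ->
  dot (L *m (D *m vec psi)) (L *m (D *m vec psi))
  <= 3 * (opnorm L ^+ 4 / m%:R ^+ 2 * dot p p + opnorm L ^+ 4 / m%:R ^+ 2 * dot q q
          + opnorm (L *m D) ^+ 2 * frob (K *m psi)).
Proof.
move=> Lh; rewrite D_tracker Lh (mulmxDr L p q) (mulmxDr L _ (D *m _)) -scalemxAr.
rewrite (mulmxDr L (L *m p)) scalerDr (mulmxA L D) (mulmxA L L p) (mulmxA L L q).
apply: le_trans (sqD_le3 _ _ _) _; rewrite ler_wpM2l // !sqZ.
have LLv (v : 'cV[R]_m) : dot (L *m L *m v) (L *m L *m v) <= opnorm L ^+ 4 * dot v v.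
  rewrite -mulmxA; apply: le_trans (opnorm_sq _ _) _.
  by rewrite (exprD _ 2 2) -mulrA ler_wpM2l ?sqr_ge0 // opnorm_sq.
have m2 : 0 <= (m%:R ^-1 : R) ^+ 2 by rewrite sqr_ge0.
have := ler_wpM2l m2 (LLv p); have := ler_wpM2l m2 (LLv q).
have := opnorm_sq (L *m D) (vec (K *m psi)); rewrite sq_vec exprVn -!mulmxA; lra.
Qed.

End Coalition.

(** * Laplacians and observers *)

Section Laplacian.
Context {R : realType} {N : nat} {n : 'I_N -> nat}.
Variables (edge : rel 'I_(nsum n)) (i : 'I_N).
Hypothesis edge_sym : symmetric edge.
Local Notation L := (laplacian edge i : 'M[R]_(n i)).
Local Notation D := (laplacian_rows edge i : 'M[R]_(n i, n i * n i)).
Local Notation J := (averaging_mx (n i) : 'M[R]_(n i)).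

Lemma laplacian_sym : L^T = L.
Proof.
apply/matrixP => j m; rewrite !mxE [m == j]eq_sym /subedge /= edge_sym.
by case: eqVneq => [->|]; rewrite ?muln0.
Qed.

Lemma laplacian_sumE j (v : 'I_(n i) -> R) :
  \sum_m L j m * v m = \sum_(m | subedge edge m j) (v j - v m).
Proof.
rewrite sumrB sumr_const (eq_bigr (fun m =>
  (#|[pred h | subedge edge h j]| * (j == m))%:R * v m - (subedge edge m j)%:R * v m)).
  rewrite sumrB; congr (_ - _).
    rewrite (bigD1 j) //= eqxx muln1 big1 ?addr0 ?mulr_natl // => m mj.
    by rewrite eq_sym (negbTE mj) muln0 mul0r.
  by rewrite [RHS]big_mkcond; apply: eq_bigr => m _; case: ifP; rewrite ?mul1r ?mul0r.
by move=> m _; rewrite !mxE mulrBl.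
Qed.

Lemma laplacian_mulE (v : 'cV[R]_(n i)) j :
  (L *m v) j 0 = \sum_(m | subedge edge m j) (v j 0 - v m 0).
Proof. by rewrite mxE -(laplacian_sumE j (fun m => v m 0)). Qed.

Lemma laplacian_averaging : L *m J = 0.
Proof.
apply/matrixP => j m; rewrite mxE (laplacian_sumE j (fun k => J k m)) big1 ?mxE //.
by move=> k _; rewrite !mxE subrr.
Qed.

Lemma laplacian_rows_vec (G : 'M[R]_(n i)) :
  D *m vec G = \col_j \sum_l L j l * G j l.
Proof.
apply/colP => j; rewrite mxE [RHS]mxE.
under eq_bigr do rewrite [D _ _]mxE [vec _ _ _]mxE.
rewrite (sum_mxtens (fun a b => (if a == j then L j b else 0) * G a b)).
rewrite (bigD1 j) //= eqxx [X in _ + X]big1 ?addr0 // => a aj.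
by rewrite big1 // => b _; rewrite (negbTE aj) mul0r.
Qed.

(** Swapping the two ends of the edges gives a second expression of the form; the sum of both
    completes the squares. *)
Lemma laplacian_quad (v : 'cV[R]_(n i)) :
  2 * dot v (L *m v)
  = \sum_j \sum_(m | subedge edge m j) (v j 0 - v m 0) ^+ 2.
Proof.
have E : dot v (L *m v)
    = \sum_j \sum_(m | subedge edge m j) v j 0 * (v j 0 - v m 0).
  by rewrite dotE; apply: eq_bigr => j _; rewrite laplacian_mulE mulr_sumr.
have E' : dot v (L *m v)
    = \sum_j \sum_(m | subedge edge m j) v m 0 * (v m 0 - v j 0).
  rewrite E (exchange_big_dep predT) //=; apply: eq_bigr => j _.
  by apply: eq_bigl => m; rewrite /subedge /= edge_sym.
rewrite mulr_natl mulr2n {1}E E' -big_split; apply: eq_bigr => j _.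
by rewrite -big_split; apply: eq_bigr => m _ /=; ring.
Qed.

(** [L *m v] is [D] applied to the matrix whose rows all equal [v], of squared Frobenius norm n
    |v|^2. *)
Lemma opnorm_laplacian_le : opnorm L ^+ 2 <= (n i)%:R * opnorm D ^+ 2.
Proof.
apply: opnorm_le_bound => [|v]; first by rewrite mulr_ge0 ?sqr_ge0.
have -> : L *m v = D *m vec (\matrix_(j, l) v l 0).
  rewrite laplacian_rows_vec; apply/colP => j; rewrite mxE [RHS]mxE.
  by apply: eq_bigr => l _; congr (_ * _); rewrite mxE.
apply: le_trans (opnorm_sq _ _) _; rewrite sq_vec /frob.
under eq_bigr do under eq_bigr do rewrite mxE.
have -> : \sum_l v l 0 ^+ 2 = dot v v by rewrite dotE; apply: eq_bigr.
by rewrite sumr_const card_ord -[dot v v *+ _]mulr_natl mulrCA mulrA.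
Qed.

Hypothesis sub_conn : forall j m, connect (subedge edge (i:=i)) j m.

Lemma laplacian_ker (v : 'cV[R]_(n i)) : L *m v = 0 -> forall j k, v j 0 = v k 0.
Proof.
move=> Lv; have := laplacian_quad v; rewrite Lv dot0r mulr0 => /esym/eqP.
rewrite psumr_eq0 => [/allP H|j _]; last by apply: sumr_ge0 => *; apply: sqr_ge0.
have adj j k : subedge edge k j -> v k 0 = v j 0.
  move=> kj; have := H j (mem_index_enum j); rewrite psumr_eq0 => [/allP/(_ k)|*].
    by rewrite mem_index_enum kj => /(_ isT); rewrite sqrf_eq0 subr_eq0 => /eqP.
  exact: sqr_ge0.
move=> j k; have /connectP[p] := sub_conn j k.
elim: p j => [|h p IH] j /=; first by move=> _ ->.
by case/andP => jh hp kE; rewrite (adj _ _ jh) (IH h).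
Qed.

(** Multiplying by [J] shows that a kernel vector is killed by [J], hence by [L]. Connectivity makes
    it constant, and a constant of zero mean vanishes. *)
Lemma laplacian_averaging_unit : (0 < n i)%N -> L + J \in unitmx.
Proof.
move=> n0; rewrite -unitmx_tr -row_free_unit -kermx_eq0; apply/eqP/row_matrixP => r.
rewrite row0; set w := row r _.
have wE : w *m (L + J)^T = 0.
  by rewrite /w -row_mul mulmx_ker row0.
have {wE} H : (L + J) *m w^T = 0 by rewrite -[L + J]trmxK -trmx_mul wE trmx0.
apply: trmx_inj; rewrite trmx0.
have Jw : J *m w^T = 0.
  have : J *m ((L + J) *m w^T) = 0 by rewrite H mulmx0.
  rewrite mulmxA mulmxDr averaging_idem // averaging_mulL ?add0r //.
  - exact: laplacian_sym.
  - exact: laplacian_averaging.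
have Lw : L *m w^T = 0 by move: H; rewrite mulmxDl Jw addr0.
have wc := centered_eq0 n0 (laplacian_ker Lw).
by move: wc; rewrite mulmxBl mul1mx Jw subr0.
Qed.

End Laplacian.

(** * The observer matrix and its gain *)

Section Observer.
Context {R : realType} {N : nat} {n : 'I_N -> nat}.
Variables (edge : rel 'I_(nsum n)) (W : 'M[R]_(nsum n)).
Local Notation ns := (nsum n).
Local Notation M := (observer_mx edge W).
Hypothesis W_weights : observer_weights edge W.

Lemma observer_mulE (V : 'M[R]_ns) :
  M *m vec V = vec (W *m V + \matrix_(a, b) (wbar edge W a b * V a b)).
Proof.
rewrite mulmxDl; apply/colP => c; rewrite mxE [in RHS]mxE [in RHS]mxE.
case: (mxtens_indexP c) => a b; rewrite mxtens_indexK /=; congr (_ + _).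
  rewrite mxE [RHS]mxE.
  transitivity (\sum_(c < ns * ns) W a (mxtens_unindex c).1
      * (b == (mxtens_unindex c).2)%:R * V (mxtens_unindex c).1 (mxtens_unindex c).2).
    by apply: eq_bigr => d _; rewrite !mxE mxtens_indexK.
  rewrite (sum_mxtens (fun a' b' => W a a' * (b == b')%:R * V a' b')).
  apply: eq_bigr => a' _; rewrite (bigD1 b) //= eqxx mulr1 [X in _ + X]big1 ?addr0 // => b' bb.
  by rewrite eq_sym (negbTE bb) mulr0 mul0r.
by rewrite mul_diag_mx !mxE mxtens_indexK.
Qed.

Lemma sum_neighbors a (F : 'I_ns -> R) :
  \sum_(c | edge c a) W a c * F c = \sum_c W a c * F c.
Proof.
have [_ _ W0 _] := W_weights; rewrite big_mkcond; apply: eq_bigr => c _.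
by case: ifP => // /negbT /W0 ->; rewrite mul0r.
Qed.

Lemma wbarE a b : wbar edge W a b = 1 - \sum_c W a c - W a b.
Proof.
rewrite /wbar; congr (_ - _ - _); transitivity (\sum_(c | edge c a) W a c * 1).
  by apply: eq_bigr => c _; rewrite mulr1.
by rewrite sum_neighbors; apply: eq_bigr => c _; rewrite mulr1.
Qed.

Lemma observer_weights_ge0 a b : 0 <= W a b.
Proof.
have [_ Wp W0 _] := W_weights.
by case: (boolP (edge b a)) => [/Wp/ltW|/W0 ->].
Qed.

(** Applied to the table with a single 1 at (a, a), [1 - M] has there the entry 1 - wbar a a, the
    row sum of [W] because W a a = 0. The weights being nonnegative, the squared row sum dominates
    the sum of squares. *)
Lemma sq_observer_weights :
  frob W <= ns%:R * opnorm (1%:M - M) ^+ 2.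
Proof.
have [Wd _ _ _] := W_weights.
rewrite mulr_natl -[X in _ *+ X]card_ord -sumr_const; apply: ler_sum => a _.
set s := \sum_c W a c.
have s0 : 0 <= s by apply: sumr_ge0 => c _; apply: observer_weights_ge0.
apply: (@le_trans _ _ (s ^+ 2)).
  rewrite expr2 /s mulr_suml; apply: ler_sum => c _.
  rewrite expr2 ler_wpM2l ?observer_weights_ge0 //.
  by rewrite (bigD1 c) //= lerDl sumr_ge0 // => *; apply: observer_weights_ge0.
pose V : 'M[R]_ns := delta_mx a a.
have := opnorm_sq (1%:M - M) (vec V); rewrite sq_vec.
have -> : frob V = 1.
  rewrite /frob (bigD1 a) //= [X in _ + X]big1 => [|c ca].
    rewrite addr0 (bigD1 a) //= [X in _ + X]big1 => [|c ca].
      by rewrite !mxE !eqxx expr1n !addr0.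
    by rewrite mxE (negbTE ca) andbF expr0n.
  by rewrite [LHS]big1 // => d _; rewrite mxE (negbTE ca) expr0n.
rewrite mulr1; apply: le_trans.
rewrite mulmxBl mul1mx observer_mulE.
rewrite dotE (bigD1 (mxtens_index (a, a))) //= ler_wpDr ?sumr_ge0 //.
  by move=> c _; rewrite -expr2 sqr_ge0.
rewrite !mxE mxtens_indexK /= !eqxx wbarE Wd mulr1.
have -> : \sum_j W a j * V j a = 0.
  apply: big1 => c _; rewrite mxE eqxx andbT.
  by case: eqVneq => [->|_]; rewrite ?Wd ?mul0r ?mulr0.
by rewrite subr0 !add0r opprB addrC subrK -expr2.
Qed.

Variable WM : 'M[R]_(ns * ns).
Hypothesis WM_lyap : lyapunov_solution M WM.
Local Notation gain := (input_gain M WM 1%:M).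

Lemma observer_input_gain : gain = 2 * opnorm (M^T *m WM) ^+ 2 + opnorm WM.
Proof. by rewrite /input_gain trmx1 mul1mx !mulmx1. Qed.

Hypothesis ns_gt0 : (0 < ns)%N.

Lemma observer_input_gain_ge1 : 1 <= gain.
Proof.
pose V : 'cV[R]_(ns * ns) := const_mx 1.
have V0 : 0 < dot V V.
  rewrite sq_gt0; apply/negP => /eqP/colP/(_ (mxtens_index (Ordinal ns_gt0, Ordinal ns_gt0))).
  by rewrite !mxE; apply/eqP/oner_neq0.
have := sq_input_gain 1%:M WM_lyap V.
by rewrite mul1mx -{1}[dot V V]mul1r ler_pM2r.
Qed.

(** The table of ones solves V = M V + vec W, so [lyapunov_fixed] bounds its squared norm, nsum^2,
    by twice the gain times [frob W]. *)
Lemma observer_gain_norm : ns%:R <= 2 * gain * opnorm (1%:M - M) ^+ 2.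
Proof.
pose V : 'M[R]_ns := const_mx 1.
have nsp : 0 < ns%:R :> R by rewrite ltr0n.
have VE : vec V = M *m vec V + 1%:M *m vec W.
  rewrite mul1mx observer_mulE -vecD; congr vec; apply/matrixP => a b; rewrite !mxE.
  have -> : \sum_j W a j * V j b = \sum_j W a j.
    by apply: eq_bigr => c _; rewrite mxE mulr1.
  by rewrite wbarE; ring.
have := lyapunov_fixed WM_lyap VE; rewrite !sq_vec.
have -> : frob V = ns%:R * ns%:R.
  rewrite mulr_natl -[X in _ *+ X]card_ord -sumr_const; apply: eq_bigr => a _.
  rewrite -[X in X%:R]card_ord -sumr_const; apply: eq_bigr => b _.
  by rewrite mxE expr1n.
move=> H; have g0 : 0 <= 2 * gain by rewrite mulr_ge0 // input_gain_ge0.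
have := ler_wpM2l g0 sq_observer_weights => H2.
by rewrite -(ler_pM2l nsp); lra.
Qed.

End Observer.

(** * Equilibria *)

Section Calculus.
Context {R : realType}.

Lemma derive_ge (V : normedModType R) (g : V -> R) x v c : derivable g x v ->
  (forall h, 0 < h -> h <= 1 -> c <= h^-1 * (g (h *: v + x) - g x)) ->
  c <= 'D_v g x.
Proof.
move=> dg H; rewrite /derive cvg_at_rightE //.
apply: limr_ge.
  exact/cvgP/cvg_dnbhs_at_right/dg.
near=> h; apply: H; first by near: h; exact: nbhs_right_gt.
by near: h; apply: nbhs_right_le; exact: ltr01.
Unshelve. all: by end_near. Qed.

Lemma derive_le (V : normedModType R) (g : V -> R) x v c : derivable g x v ->
  (forall h, 0 < h -> h <= 1 -> h^-1 * (g (h *: v + x) - g x) <= c) ->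
  'D_v g x <= c.
Proof.
move=> dg H; rewrite -lerN2 -deriveN //.
apply: derive_ge; first exact: derivableN.
move=> h h0 h1; have := H h h0 h1; rewrite -lerN2 => /le_trans; apply.
by rewrite -mulrN opprB /= !opprK addrC.
Qed.

Lemma derive_gradient m (g : 'cV[R]_m -> R) x v :
  differentiable g x -> 'D_v g x = dot v (gradient g x).
Proof.
move=> dg; rewrite deriveE // [v in LHS]matrix_sum_delta.
rewrite linear_sum dotE /=; apply: eq_bigr => a _.
by rewrite big_ord1 linearZ /= -deriveE // mxE.
Qed.

Lemma geometric_increments_cvg (u : R^nat) (c q : R) :
  0 <= q -> q < 1 -> (forall k, `|u k.+1 - u k| <= c * q ^+ k) -> cvgn u.
Proof.
move=> q0 q1 H.
have E : u = (fun k => u 0%N + series (telescope u) k).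
  by apply/funext => k; rewrite -eq_sum_telescope.
rewrite E; apply: is_cvgD; first exact: is_cvg_cst.
apply: normed_cvg; apply: (@series_le_cvg _ _ (geometric c q)).
- by move=> k /=.
- by move=> k; apply: le_trans (normr_ge0 _) (H k).
- by move=> k; exact: H.
- by apply: is_cvg_geometric_series; rewrite ger0_norm.
Qed.

End Calculus.

(** * Profiles, their blocks and unilateral deviations *)

Section Stacking.
Context {R : realType} {N : nat} {n : 'I_N -> nat}.
Local Notation ns := (nsum n).

Lemma sum_agents (V : nmodType) (F : 'I_ns -> V) :
  \sum_a F a = \sum_i \sum_(j < n i) F (agent i j).
Proof.
rewrite (reindex (@tagnat.rank _ n)) /=; last first.
  by exists (@tagnat.sig _ n) => ? _; rewrite (tagnat.rankK, tagnat.sigK).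
pose G i (j : 'I_(n i)) := F (agent i j).
rewrite (eq_bigr (fun p => G (tag p) (tagged p))) => [|p _]; last first.
  by rewrite /G -tagnat.rankE.
by rewrite -(sig_big_dep predT (fun=> predT)).
Qed.

Lemma submxcolE (x : 'cV[R]_ns) i j : submxcol x i j 0 = x (agent i j) 0.
Proof. by rewrite mxE. Qed.

Lemma submxcol_inj (x y : 'cV[R]_ns) : (forall i, submxcol x i = submxcol y i) -> x = y.
Proof. by move=> H; rewrite -[x]submxcolK -[y]submxcolK; apply: eq_mxcol. Qed.

Lemma dot_blocks (x y : 'cV[R]_ns) :
  dot x y = \sum_i dot (submxcol x i) (submxcol y i).
Proof.
rewrite dotE sum_agents; apply: eq_bigr => i _; rewrite dotE.
by apply: eq_bigr => j _; rewrite !submxcolE.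
Qed.

Lemma sq_block_le (x : 'cV[R]_ns) i : dot (submxcol x i) (submxcol x i) <= dot x x.
Proof.
rewrite dot_blocks (bigD1 i) //= lerDl sumr_ge0 // => k _; exact: sq_ge0.
Qed.

Lemma submxcolZ c (x : 'cV[R]_ns) i : submxcol (c *: x) i = c *: submxcol x i.
Proof. by apply/colP => j; rewrite !mxE. Qed.

Lemma submxcol_deviate (x : 'cV[R]_ns) i (y : 'cV[R]_(n i)) :
  submxcol (deviate x y) i = y.
Proof. by rewrite mxcolK; exact: (@dfwith_in _ (fun h => 'cV[R]_(n h))). Qed.

Lemma submxcol_deviate_out (x : 'cV[R]_ns) i (y : 'cV[R]_(n i)) k :
  i != k -> submxcol (deviate x y) k = submxcol x k.
Proof. by move=> ik; rewrite mxcolK; exact: (@dfwith_out _ (fun h => 'cV[R]_(n h))). Qed.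

Lemma deviateE (x : 'cV[R]_ns) i (y : 'cV[R]_(n i)) :
  deviate x y = x + deviate 0 (y - submxcol x i).
Proof.
apply: submxcol_inj => k; rewrite submxcolD.
have [ik|ik] := eqVneq i k; last by rewrite !submxcol_deviate_out // submxcol0 addr0.
by case: _ / ik; rewrite !submxcol_deviate addrC subrK.
Qed.

Lemma dot_deviate0 i (w : 'cV[R]_(n i)) (g : 'cV[R]_ns) :
  dot (deviate 0 w) g = dot w (submxcol g i).
Proof.
rewrite dot_blocks (bigD1 i) //= submxcol_deviate [X in _ + X]big1 ?addr0 // => k ki.
by rewrite submxcol_deviate_out 1?eq_sym // submxcol0 dot0l.
Qed.

Lemma deviate0Z c i (w : 'cV[R]_(n i)) : deviate 0 (c *: w) = c *: deviate 0 w.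
Proof.
apply: submxcol_inj => k; rewrite submxcolZ.
have [ik|ik] := eqVneq i k; last by rewrite !submxcol_deviate_out // submxcol0 scaler0.
by case: _ / ik; rewrite !submxcol_deviate.
Qed.

(** The orthogonal projector onto the directions that keep every coalition sum. *)
Definition centering_mx : 'M[R]_ns := \mxdiag_i @Ibar R N n i.

Lemma submxcol_centering (x : 'cV[R]_ns) i :
  submxcol (centering_mx *m x) i = @Ibar R N n i *m submxcol x i.
Proof. by rewrite -{1}[x]submxcolK mul_mxdiag_mxcol mxcolK. Qed.

Lemma centering_mx_sym : centering_mx^T = centering_mx.
Proof.
rewrite tr_mxdiag; congr mxdiag; apply/functional_extensionality_dep => i.
by rewrite /Ibar linearB /= trmx1 averaging_tr.
Qed.

Lemma centering_mx_idem : (forall i, (0 < n i)%N) -> centering_mx *m centering_mx = centering_mx.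
Proof.
move=> n_gt0; apply: trmx_inj; apply/matrixP => a b.
have H (v : 'cV[R]_ns) : centering_mx *m (centering_mx *m v) = centering_mx *m v.
  apply: submxcol_inj => i; rewrite !submxcol_centering mulmxA; congr (_ *m _).
  exact: centered_idem.
have := H (delta_mx a 0); rewrite mulmxA -!colE => /colP/(_ b).
by rewrite !mxE.
Qed.

End Stacking.

(** * First-order characterization of the Nash equilibrium *)

Section Equilibrium.
Context {R : realType} {N : nat} {n : 'I_N -> nat}.
Local Notation ns := (nsum n).
Variables (f : 'I_ns -> 'cV[R]_ns -> R) (res : 'I_ns -> R).
Variables (l : 'I_ns -> R) (mu : R).
Hypothesis n_gt0 : forall i, (0 < n i)%N.
Hypothesis f_convex : forall a, @convex_function R 'cV[R]_ns setT (f a).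
Hypothesis f_diff : forall a x, differentiable (f a) x.
Hypothesis f_lip : forall a, euclidean_lipschitz (l a) (gradient (f a)).
Hypotheses (mu_gt0 : 0 < mu) (P_mono : strongly_monotone mu (pseudo_gradient f)).
Local Notation P := (pseudo_gradient f).
Local Notation K i := (@Ibar R N n i).

Definition coalition_gradient i (x : 'cV[R]_ns) : 'cV[R]_ns :=
  \sum_(k < n i) gradient (f (agent i k)) x.

Lemma coalition_cost_sum i : coalition_cost f i = \sum_(k < n i) f (agent i k).
Proof. by apply/funext => x; rewrite /coalition_cost fct_sumE. Qed.

Lemma derive_coalition_cost i x v :
  'D_v (coalition_cost f i) x = dot v (coalition_gradient i x).
Proof.
rewrite coalition_cost_sum derive_sum => [|k]; last exact: diff_derivable.
rewrite dotC dot_suml; apply: eq_bigr => k _.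
by rewrite derive_gradient // dotC.
Qed.

Lemma derivable_coalition_cost i x v : derivable (coalition_cost f i) x v.
Proof.
by rewrite coalition_cost_sum; apply: derivable_sum => k; exact: diff_derivable.
Qed.

Lemma submxcol_pseudo_gradient i x :
  submxcol (P x) i = submxcol (coalition_gradient i x) i.
Proof.
rewrite mxcolK; apply/colP => j; rewrite mxE submxcolE /partial.
rewrite derive_coalition_cost dotE (bigD1 (agent i j)) //= mxE !eqxx mul1r.
by rewrite [X in _ + X]big1 ?addr0 // => a /negbTE aj; rewrite mxE aj mul0r.
Qed.

Lemma convex_derive_le a x y : 'D_(y - x) (f a) x <= f a y - f a x.
Proof.
apply: derive_le; first exact: diff_derivable.
move=> h h0 h1; rewrite ler_pdivrMl //.
have := f_convex a (Itv01 (ltW h0) h1) (mem_set (I : setT y)) (mem_set (I : setT x)).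
move=> H; have {H} : f a (h *: y + (1 - h) *: x) <= h * f a y + (1 - h) * f a x := H.
have -> : h *: (y - x) + x = (h *: y + (1 - h) *: x : 'cV[R]_ns).
  by rewrite scalerBr scalerBl scale1r addrAC -addrA.
lra.
Qed.

(** Each block of the pseudo-gradient is a multiple of the all-ones vector, the factor being the
    multiplier of the resource constraint. *)
Definition stationary x : Prop := forall i, K i *m submxcol (P x) i = 0.

Lemma feasible_sub i (y z : 'cV[R]_(n i)) :
  feasible res y -> feasible res z -> \sum_j (y - z) j 0 = 0.
Proof.
move=> fy fz; rewrite (eq_bigr (fun j => y j 0 - z j 0)) => [|j _]; last by rewrite !mxE.
by rewrite sumrB fy fz subrr.
Qed.

Lemma dot_stationary x i (w : 'cV[R]_(n i)) :
  stationary x -> \sum_j w j 0 = 0 -> dot w (submxcol (P x) i) = 0.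
Proof.
move=> /(_ i); rewrite mulmxBl mul1mx => /eqP; rewrite subr_eq0 => /eqP -> w0.
by rewrite dot_mul averaging_tr averaging_eq0 ?dot0l.
Qed.

(** Moving along the centered gradient w or its opposite keeps feasibility, so the slope, which is
    |w|^2 along w, is zero. *)
Lemma nash_stationary x : nash_equilibrium f res x -> stationary x.
Proof.
move=> [fx Nx] i; set w := K i *m _.
suff H c : 0 <= dot (c *: w) (submxcol (P x) i).
  apply/eqP; rewrite -sq_eq0; apply/eqP.
  have -> : dot w w = dot w (submxcol (P x) i).
    rewrite dot_mul {2}/w /Ibar linearB /= trmx1 averaging_tr mulmxA.
    by rewrite centered_idem.
  by apply/eqP; rewrite eq_le; have := H 1; have := H (-1); rewrite !dotZl; lra.
rewrite submxcol_pseudo_gradient -dot_deviate0 -derive_coalition_cost.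
apply: derive_ge; first exact: derivable_coalition_cost.
move=> h h0 _; apply: mulr_ge0; first by rewrite invr_ge0 ltW.
rewrite subr_ge0.
have fw : feasible res (submxcol x i + h *: (c *: w)).
  rewrite /feasible -(fx i); transitivity
    (\sum_j (submxcol x i j 0 + h * (c * w j 0))).
    by apply: eq_bigr => j _; rewrite mxE; congr (_ + _); rewrite !mxE.
  by rewrite big_split /= -!mulr_sumr sum_centered // !mulr0 addr0.
have := Nx i _ fw; rewrite deviateE.
have -> : submxcol x i + h *: (c *: w) - submxcol x i = h *: (c *: w).
  by rewrite addrC addKr.
by rewrite !deviate0Z [x + _]addrC.
Qed.

(** The tangent inequalities of the members are summed; the total slope pairs a feasible, hence
    centered, displacement with a constant block. *)
Lemma stationary_nash x : (forall i, feasible res (submxcol x i)) ->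
  stationary x -> nash_equilibrium f res x.
Proof.
move=> fx Sx; split=> // i y fy; rewrite -subr_ge0.
suff <- : \sum_(k < n i) 'D_(deviate x y - x) (f (agent i k)) x = 0.
  by rewrite -sumrB; apply: ler_sum => k _; exact: convex_derive_le.
rewrite -[RHS](dot_stationary Sx (feasible_sub fy (fx i))).
rewrite submxcol_pseudo_gradient -dot_deviate0 dotC dot_suml.
apply: eq_bigr => k _; rewrite derive_gradient // dotC deviateE.
by rewrite [x + _]addrC addrK.
Qed.

(** The blocks of x - y are centered, hence orthogonal to those of both pseudo-gradients; strong
    monotonicity concludes. *)
Lemma stationary_unique x y :
  (forall i, feasible res (submxcol x i)) -> (forall i, feasible res (submxcol y i)) ->
  stationary x -> stationary y -> x = y.
Proof.
move=> fx fy Sx Sy; have := P_mono x y; rewrite dot_blocks [X in _ <= X]big1 => [H|i _].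
  apply/eqP; rewrite -subr_eq0 -sq_eq0 -enorm_sq eq_le sqr_ge0 andbT.
  by rewrite -(pmulr_rle0 _ mu_gt0).
by rewrite !submxcolB dotDr dotNr !dot_stationary ?subr0 //; apply: feasible_sub.
Qed.

Lemma gradient_lip_sq a x y :
  dot (gradient (f a) x - gradient (f a) y) (gradient (f a) x - gradient (f a) y)
  <= l a ^+ 2 * dot (x - y) (x - y).
Proof.
rewrite -!enorm_sq -exprMn ler_pXn2r ?nnegrE ?enorm_ge0 ?f_lip //.
exact: le_trans (enorm_ge0 _) (f_lip _ _ _).
Qed.

End Equilibrium.

Lemma cvg_finsum (R : realType) m (u : 'I_m -> R^nat) (l : 'I_m -> R) :
  (forall a, u a @ \oo --> l a) -> (fun k => \sum_a u a k) @ \oo --> \sum_a l a.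
Proof.
elim: m u l => [|m IH] u l ul.
  rewrite big_ord0 (_ : (fun k => _) = fun=> 0); first exact: cvg_cst.
  by apply/funext => k; rewrite big_ord0.
rewrite big_ord_recl (_ : (fun k => _) =
    (fun k => u ord0 k + \sum_(a < m) u (lift ord0 a) k)).
  by apply: cvgD; [exact: ul|apply: (IH (fun a => u (lift ord0 a)))].
by apply/funext => k; rewrite big_ord_recl.
Qed.

(** * Zeros of a projected strongly monotone map *)

Section ProjectedZero.
Context {R : realType} {m : nat}.
Variables (E : 'M[R]_m) (G : 'cV[R]_m -> 'cV[R]_m) (z0 : 'cV[R]_m) (mu c : R).
Hypotheses (E_sym : E^T = E) (E_idem : E *m E = E).
Hypotheses (mu_gt0 : 0 < mu) (c_ge0 : 0 <= c).
Hypothesis G_mono : strongly_monotone mu G.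
Hypothesis G_lip : forall x y, dot (G x - G y) (G x - G y) <= c * dot (x - y) (x - y).

Lemma entry_le_enorm (v : 'cV[R]_m) a : `|v a 0| <= enorm v.
Proof.
apply: ler_sq; first exact: enorm_ge0.
rewrite real_normK ?num_real // enorm_sq dotE (bigD1 a) //= -expr2 lerDl.
by apply: sumr_ge0 => b _; rewrite -expr2 sqr_ge0.
Qed.

Lemma enorm_le_sum (v : 'cV[R]_m) : enorm v <= \sum_a `|v a 0|.
Proof.
rewrite {1}[v]matrix_sum_delta; apply: le_trans (enorm_sum _ _) _.
apply: ler_sum => a _; rewrite big_ord1 enormZ.
rewrite [X in _ * X](_ : _ = 1) ?mulr1 //.
rewrite /enorm dotE (bigD1 a) //= big1 => [|b /negbTE ba]; last by rewrite mxE ba mul0r.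
by rewrite mxE !eqxx mulr1 addr0 sqrtr1.
Qed.

(** With tau = mu/d, the factor 1 - 2 tau mu + tau^2 c on squared distances is at most 1 - mu^2/d,
    because c <= d. The summand mu^2 + 1 makes [d] positive and this bound a number of [0, 1[. *)
Let d := c + mu ^+ 2 + 1.
Let tau := mu / d.
Let F x := x - tau *: (E *m G x).
Let z k := iter k F z0.
Let q := Num.sqrt (1 - mu ^+ 2 / d).

Let d_gt0 : 0 < d.
Proof. by rewrite ltr_wpDl // addr_ge0 // sqr_ge0. Qed.

Let q_lt1 : 0 <= 1 - mu ^+ 2 / d < 1.
Proof.
rewrite subr_ge0 ler_pdivrMr // mul1r gtrBl divr_gt0 ?exprn_gt0 // andbT.
by rewrite /d addrAC lerDr addr_ge0.
Qed.

Let F_contract x y : E *m (x - y) = x - y ->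
  dot (F x - F y) (F x - F y) <= (1 - mu ^+ 2 / d) * dot (x - y) (x - y).
Proof.
move=> Exy; have -> : F x - F y = (x - y) - tau *: (E *m (G x - G y)).
  rewrite /F mulmxBr scalerBr; move: (tau *: _) (tau *: _) => u v.
  by apply/colP => a; rewrite !mxE; ring.
rewrite sqB sqZ dotZr dot_mul E_sym Exy.
have h1 := G_mono x y; rewrite enorm_sq in h1.
have h2 : dot (E *m (G x - G y)) (E *m (G x - G y)) <= c * dot (x - y) (x - y).
  apply: le_trans (G_lip x y); set g := G x - G y.
  have EE : dot g (E *m g) = dot (E *m g) (E *m g).
    by rewrite -{1}E_idem -mulmxA dot_mul E_sym.
  by have := sq_ge0 (g - E *m g); rewrite sqB EE; lra.
have t0 : 0 < tau by rewrite divr_gt0.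
have h3 := ler_wpM2l (ltW t0) h1.
have h4 := ler_wpM2l (sqr_ge0 tau) h2.
have h5 : tau ^+ 2 * c <= mu ^+ 2 / d.
  rewrite /tau expr_div_n -mulrA ler_wpM2l ?sqr_ge0 // mulrC ler_pdivrMr ?exprn_gt0 //.
  rewrite expr2 mulrA mulVf ?gt_eqF // mul1r /d.
  by have := sqr_ge0 mu; lra.
have h6 := ler_wpM2r (sq_ge0 (x - y)) h5.
have -> : mu ^+ 2 / d = tau * mu by rewrite /tau; ring.
have E2 : mu ^+ 2 / d = tau * mu by rewrite /tau; ring.
rewrite E2 in h6; lra.
Qed.

Let z_step k : E *m (z k.+1 - z k) = z k.+1 - z k.
Proof.
rewrite /z iterS /F addrC addKr mulmxN -scalemxAr.
by rewrite mulmxA E_idem.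
Qed.

Let z_incr k : enorm (z k.+1 - z k) <= enorm (z 1%N - z 0%N) * q ^+ k.
Proof.
elim: k => [|k IH]; first by rewrite expr0 mulr1.
rewrite exprSr mulrA mulrC; apply: le_trans (ler_wpM2l (sqrtr_ge0 _) IH).
have /andP[q0 _] := q_lt1.
rewrite -sqrtrM // /enorm ler_wsqrtr // [in leLHS]/z !iterS.
exact: F_contract (z_step k).
Qed.

(** The increments of the iteration lie in the range of [E] and decay geometrically, so every
    coordinate converges; the limit is a fixed point. *)
Lemma projected_zero_exists : exists x, E *m (x - z0) = x - z0 /\ E *m G x = 0.
Proof.
pose xs := \col_a limn (fun k => z k a 0).
pose del : R^nat := fun k => \sum_a `|z k a 0 - xs a 0|.
have zc a : (fun k => z k a 0) @ \oo --> xs a 0.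
  rewrite mxE; apply: (@geometric_increments_cvg _ _ (enorm (z 1%N - z 0%N)) q).
  - exact: sqrtr_ge0.
  - have /andP[_ q1] := q_lt1; rewrite -sqrtr1 ltr_sqrt //; exact: ltr01.
  - move=> k; apply: le_trans (z_incr k).
    by apply: le_trans (entry_le_enorm _ a); rewrite !mxE.
have del0 : del @ \oo --> (0 : R).
  have <- : \sum_(a < m) (0 : R) = 0 by rewrite big1.
  apply: (cvg_finsum (u := fun a k => `|z k a 0 - xs a 0|)) => a.
  rewrite -[X in _ --> X](normr0 R).
  apply: cvg_norm; rewrite -[X in _ --> X](subrr (xs a 0)).
  by apply: cvgB => //; exact: cvg_cst.
have zx k : enorm (z k - xs) <= del k.
  apply: le_trans (enorm_le_sum _) _.
  by apply: ler_sum => a _; rewrite !mxE.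
(* A fixed vector dominated by a vanishing sequence is zero. Both claims about the limit follow this
   pattern. *)
have squeeze (v : 'cV[R]_m) b : (forall k, enorm v <= b * del k + del k.+1) -> v = 0.
  move=> H; apply/eqP; rewrite -sq_eq0 -enorm_sq sqrf_eq0 eq_le enorm_ge0 andbT.
  have C : (fun k => b * del k + del k.+1) @ \oo --> b * 0 + 0.
    apply: cvgD; first by apply: cvgM => //; exact: cvg_cst.
    by rewrite (cvg_shiftS del).
  have <- : limn (fun k => b * del k + del k.+1) = 0.
    by rewrite (cvg_lim _ C) // mulr0 addr0.
  apply: limr_ge; first exact: cvgP C.
  exact: nearW.
have del_ge0 k : 0 <= del k by apply: sumr_ge0.
exists xs; split.
  apply/eqP; rewrite -subr_eq0; apply/eqP.
  apply: (squeeze _ (opnorm (E - 1%:M))) => k.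
  have Ez : E *m (z k - z0) = z k - z0.
    elim: k => [|k IH]; first by rewrite subrr mulmx0.
    by rewrite -(subrK (z k) (z k.+1)) -addrA mulmxDr z_step IH.
  have -> : E *m (xs - z0) - (xs - z0) = - ((E - 1%:M) *m (z k - xs)).
    have -> : z k - xs = (z k - z0) - (xs - z0) by rewrite opprB addrA subrK.
    rewrite (mulmxBl E) mul1mx (mulmxBr E (z k - z0)) Ez.
    move: (z k - z0) (xs - z0) => u v; move: (E *m v) => w.
    by apply/colP => a; rewrite !mxE; ring.
  rewrite enormN; apply: le_trans (opnorm_le _ _) _.
  rewrite ler_wpDr // ler_wpM2l ?opnorm_ge0 //.
suff H : tau *: (E *m G xs) = 0.
  by apply/eqP; move/eqP: H; rewrite scaler_eq0 gt_eqF // divr_gt0.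
apply: (squeeze _ (1 + tau * (opnorm E * Num.sqrt c))) => k.
(* By definition of the iteration, z k - z k.+1 is the projected step at z k; this expresses the
   residual at the limit by distances to the limit. *)
have -> : tau *: (E *m G xs) = (z k - xs) - tau *: (E *m (G (z k) - G xs)) - (z k.+1 - xs).
  rewrite [z k.+1]iterS /F mulmxBr scalerBr -/(z k).
  move: (z k) (tau *: (E *m G (z k))) (tau *: (E *m G xs)) => u v w.
  by apply/colP => a; rewrite !mxE; ring.
apply: le_trans (enormD _ _) _; rewrite enormN lerD //.
apply: le_trans (enormD _ _) _; rewrite enormN enormZ mulrDl mul1r lerD //.
have t0 : 0 < tau by rewrite divr_gt0.
rewrite (gtr0_norm t0) -(mulrA tau) (ler_pM2l t0) -mulrA.
apply: le_trans (opnorm_le _ _) _; rewrite ler_wpM2l ?opnorm_ge0 //.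
apply: (@le_trans _ _ (Num.sqrt c * enorm (z k - xs))).
  by rewrite -sqrtrM // ler_wsqrtr.
by rewrite ler_wpM2l ?sqrtr_ge0.
Qed.

End ProjectedZero.

Section GameEquilibrium.
Context {R : realType} {N : nat} {n : 'I_N -> nat}.
Local Notation ns := (nsum n).
Variables (f : 'I_ns -> 'cV[R]_ns -> R) (res : 'I_ns -> R).
Variables (l : 'I_ns -> R) (mu : R).
Hypothesis n_gt0 : forall i, (0 < n i)%N.
Hypothesis f_convex : forall a, @convex_function R 'cV[R]_ns setT (f a).
Hypothesis f_diff : forall a x, differentiable (f a) x.
Hypothesis f_lip : forall a, euclidean_lipschitz (l a) (gradient (f a)).
Hypotheses (mu_gt0 : 0 < mu) (P_mono : strongly_monotone mu (pseudo_gradient f)).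
Local Notation P := (pseudo_gradient f).

(** The members may evaluate their gradients at different points, so [sq_sum_le] is used and the
    squared constants are summed. *)
Lemma sample_lip i (xi eta : 'I_(n i) -> 'cV[R]_ns) (v : 'cV[R]_(n i)) :
  v = \sum_j submxcol (gradient (f (agent i j)) (xi j)
                       - gradient (f (agent i j)) (eta j)) i ->
  dot v v <= lip_sqsum l i * \sum_j dot (xi j - eta j) (xi j - eta j).
Proof.
move=> ->; apply: sq_sum_le => [j|j]; first exact: sq_ge0.
apply: le_trans (sq_block_le _ _) _; exact: gradient_lip_sq.
Qed.

Lemma submxcol_pseudo_gradientB i x y :
  submxcol (P x - P y) i
  = \sum_j submxcol (gradient (f (agent i j)) x - gradient (f (agent i j)) y) i.
Proof.
rewrite submxcolB !submxcol_pseudo_gradient // -submxcolB -sumrB.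
by rewrite submxcol_sum.
Qed.

Lemma lip_sqsum_ge0 i : 0 <= lip_sqsum l i.
Proof. by apply: sumr_ge0 => j _; rewrite sqr_ge0. Qed.

Lemma pseudo_gradient_lip x y :
  dot (P x - P y) (P x - P y)
  <= (\sum_i lip_sqsum l i * (n i)%:R) * dot (x - y) (x - y).
Proof.
rewrite dot_blocks mulr_suml; apply: ler_sum => i _.
have := sample_lip (submxcol_pseudo_gradientB i x y).
by rewrite sumr_const card_ord -[_ *+ n i]mulr_natl mulrA.
Qed.

(** The iteration starts at the local resources; since the limit differs from them by a centered
    vector, it is feasible. *)
Lemma stationary_exists :
  exists xs, (forall i, feasible res (submxcol xs i)) /\ stationary f xs.
Proof.
pose z0 : 'cV[R]_ns := \col_a res a.
have [|||xs [fx Sx]] := @projected_zero_exists R ns centering_mx P z0 mu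
    (\sum_i lip_sqsum l i * (n i)%:R) _ _ mu_gt0 _ P_mono pseudo_gradient_lip.
- exact: centering_mx_sym.
- exact: centering_mx_idem.
- by apply: sumr_ge0 => i _; rewrite mulr_ge0 ?lip_sqsum_ge0.
exists xs; split=> i; last by rewrite -submxcol_centering Sx submxcol0.
have := sum_centered (n_gt0 i) (submxcol (xs - z0) i).
rewrite -submxcol_centering fx => H; rewrite /feasible /coalition_resource.
apply/eqP; rewrite -subr_eq0 -sumrB -[X in _ == X]H.
by apply/eqP/eq_bigr => j _; rewrite !mxE.
Qed.

Lemma stationary_unique_nash xs : (forall i, feasible res (submxcol xs i)) ->
  stationary f xs -> unique (nash_equilibrium f res) xs.
Proof.
move=> fx Sx; split=> [|y Ny]; first exact: stationary_nash.
apply: (stationary_unique mu_gt0 P_mono fx) => //; first by case: Ny.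
exact: nash_stationary Ny.
Qed.

End GameEquilibrium.

(** * Geometric decay and the choice of the weights *)

Section Decay.
Context {R : realType}.

(** The loss is a fixed fraction of [V], which therefore decays geometrically; [S] follows because
    eps S is at most [V]. The denominator K + 2 eps keeps q at least 1/2, and the added 1 keeps C
    positive if V starts at 0. *)
Lemma energy_decay (V S : nat -> R) (eps K : R) :
  0 < eps -> 0 <= K -> (forall k, 0 <= V k) -> (forall k, 0 <= S k) ->
  (forall k, V k.+1 <= V k - eps * S k) -> (forall k, V k <= K * S k) ->
  exists C q, [/\ 0 < C, 0 < q < 1 & forall k, S k <= C * q ^+ k].
Proof.
move=> e0 K0 V0 S0 step up; pose q := 1 - eps / (K + 2 * eps).
have K'0 : 0 < K + 2 * eps by lra.
have q1 : 0 < q < 1.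
  rewrite subr_gt0 ltr_pdivrMr // gtrBl divr_gt0 // andbT mul1r; lra.
have /andP[q0 _] := q1.
have Vq k : V k.+1 <= q * V k.
  apply: le_trans (step k) _.
  have : V k <= (K + 2 * eps) * S k.
    by rewrite mulrDl ler_wpDr // !mulr_ge0 // ltW.
  rewrite mulrC -ler_pdivrMr // => /(ler_wpM2l (ltW e0)).
  by rewrite /q; lra.
have Vk k : V k <= V 0%N * q ^+ k.
  elim: k => [|k IH]; first by rewrite expr0 mulr1.
  apply: le_trans (Vq k) _.
  by rewrite exprSr mulrA mulrC ler_wpM2r // ltW.
exists (V 0%N / eps + 1), q; split=> // [|k].
  by rewrite ltr_wpDl // divr_ge0 // ltW.
have qk : 0 <= q ^+ k by rewrite exprn_ge0 // ltW.
apply: (@le_trans _ _ (V k / eps)).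
  by rewrite ler_pdivlMr // mulrC; have := step k; have := V0 k.+1; lra.
have := ler_wpM2l (ltW (etrans (invr_gt0 _) e0)) (Vk k); lra.
Qed.

(* X, Y and Z are the squared decision, tracking and estimation errors, and
   VE, VP and VX the corresponding energies. *)
Lemma weights_exist (ns b beta mu g T S d2 k2 k3 kap : R) :
  1 <= ns -> ns <= b -> 0 < beta -> 0 < mu ->
  0 <= g -> 0 <= T -> 0 <= S -> 0 <= d2 -> 0 <= k2 -> 0 <= k3 -> 0 <= kap ->
  64 * beta * (g * T) * (d2 * b) <= mu -> 32 * beta * ns ^+ 2 * (g * T) <= mu ->
  8 * beta * S * b <= mu -> beta * mu * (g * T) <= T / 32 ->
  2 * beta * mu * k2 <= g -> 16 * beta ^+ 2 * (k3 * b) <= 1 ->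
  kap <= ns * (g * S) -> kap <= ns * k3 ->
  exists a c eps : R, [/\ 0 <= a, 0 <= c, 0 < eps &
    forall X Y Z VE VP VX VE' VP' VX' D : R,
    0 <= X -> 0 <= Y -> 0 <= Z ->
    VE' <= VE - 3 / 2 * beta * mu * X + 2 * beta / mu * ns * T * Z
           + beta ^+ 2 * g * (11 * T * (Z + ns * X) + 3 / 2 * Y) ->
    VP' <= VP - 2^-1 * Y + T * d2 * Z ->
    VX' <= VX - 2^-1 * Z + b * D ->
    D <= 3 * beta ^+ 2 * (kap * X + k3 * Z + k2 * Y) ->
    VE' + a * VP' + c * VX' <= VE + a * VP + c * VX - eps * (X + Y + Z)].
Proof.
move=> ns1 nsb beta0 mu0 g0 T0 S0 d0 k20 k30 kap0 hA hA' hB hmu h2 h3 hk1 hk2.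
have b0 : 0 < b by lra.
have ns0 : 0 < ns by lra.
(* 2 t is the leading coefficient of Z in the decision energy. In the observer weight c = 16 t + w,
   the first part absorbs it, while [w] keeps c positive when T = 0 and is scaled so that w b = beta
   mu. *)
pose w := beta * mu / b; pose t := beta / mu * (ns * T).
have w0 : 0 < w by rewrite divr_gt0 ?mulr_gt0.
have bm0 : 0 < beta / mu by rewrite divr_gt0.
have nsT0 : 0 <= ns * T by rewrite mulr_ge0 // ltW.
have t0 : 0 <= t by rewrite mulr_ge0 // ltW.
pose c := 16 * t + w.
have c0 : 0 < c by rewrite /c; lra.
(* A small extra tracker weight: it leaves a strict decrease in Y even when g = 0 and costs at most
   w/16 in Z. *)
pose e := w / (16 * (T * d2 + 1)).
have Td0 : 0 <= T * d2 by rewrite mulr_ge0.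
have e0 : 0 < e by rewrite divr_gt0 // mulr_gt0 //; lra.
have eTd : e * (T * d2) <= w / 16.
  rewrite /e mulrAC ler_pdivrMr; last by rewrite mulr_gt0 //; lra.
  by have := ler_wpM2l (ltW w0) Td0; lra.
(* Up to the factor 3/2, [y1] is the coefficient of Y in the decision energy and [y2] bounds the one
   entering through the observer. Half of a = 4 y1 + 4 y2 + e dominates both. *)
pose y1 := beta ^+ 2 * g; pose y2 := c * (beta / mu) * g * b.
have y10 : 0 <= y1 by rewrite mulr_ge0 ?sqr_ge0.
have y20 : 0 <= y2.
  by apply: mulr_ge0; [apply: mulr_ge0 => //; apply: mulr_ge0; apply: ltW|apply: ltW].
pose a := 4 * y1 + 4 * y2 + e.
have wb : w * b = beta * mu by rewrite divfK ?gt_eqF.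
have X1 : y1 * (11 * T * ns) <= 11 / 32 * (beta * mu).
  have h : ns <= ns ^+ 2 by rewrite expr2 ler_peMl // ltW.
  have gT : 0 <= beta * (g * T) := mulr_ge0 (ltW beta0) (mulr_ge0 g0 T0).
  have := ler_wpM2l (ltW beta0) hA'; have := ler_wpM2l (ltW beta0) (ler_wpM2l gT h).
  by rewrite /y1; lra.
(* The loop from X through the observer back to X: the part 16 t of c is paid by the product of
   [hA'] and [hB], the part [w] by [h3] and ns <= b. *)
have X2 : c * b * (3 * beta ^+ 2 * kap) <= 3 / 8 * (beta * mu).
  have -> : c * b * (3 * beta ^+ 2 * kap)
    = 48 * (beta / mu) * (beta ^+ 2 * (ns * T * b)) * kap
      + 3 * (beta * mu) * (beta ^+ 2 * kap).
    by rewrite /c mulrDl wb /t; ring.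
  have P1 : 0 <= 48 * (beta / mu) * (beta ^+ 2 * (ns * T * b)).
    exact: mulr_ge0 (mulr_ge0 (ler0n _ 48) (ltW bm0))
      (mulr_ge0 (sqr_ge0 _) (mulr_ge0 nsT0 (ltW b0))).
  have P2 : 0 <= 3 * (beta * mu) * beta ^+ 2.
    exact: mulr_ge0 (mulr_ge0 (ler0n _ 3) (ltW (mulr_gt0 beta0 mu0))) (sqr_ge0 _).
  have Q1 := ler_wpM2l P1 hk1; have Q2 := ler_wpM2l P2 hk2.
  have Q3 : 3 * (beta * mu) * beta ^+ 2 * (ns * k3) <= 3 / 16 * (beta * mu).
    have h : ns * k3 <= k3 * b by rewrite mulrC ler_wpM2l.
    have := ler_wpM2l P2 h; have := ler_wpM2l (ltW (mulr_gt0 beta0 mu0)) h3; lra.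
  have Q4 : 48 * (beta / mu) * (beta ^+ 2 * (ns * T * b)) * (ns * (g * S))
      <= 3 / 16 * (beta * mu).
    have u0 : 0 <= 32 * beta * ns ^+ 2 * (g * T).
      exact: mulr_ge0 (mulr_ge0 (mulr_ge0 (ler0n _ 32) (ltW beta0)) (sqr_ge0 _))
        (mulr_ge0 g0 T0).
    have v0 : 0 <= 8 * beta * S * b.
      exact: mulr_ge0 (mulr_ge0 (mulr_ge0 (ler0n _ 8) (ltW beta0)) S0) (ltW b0).
    have := ler_wpM2l (ltW bm0) (ler_pM u0 v0 hA' hB).
    have -> : beta / mu * (mu * mu) = beta * mu by field; rewrite gt_eqF.
    by lra.
  by lra.
have Z1 : y1 * (11 * T) <= 11 / 32 * t.
  have h : T <= ns * T by rewrite ler_peMl.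
  have := ler_wpM2l (ltW bm0) hmu; have := ler_wpM2l (ltW bm0) h.
  have -> : beta / mu * (beta * mu * (g * T)) = beta ^+ 2 * (g * T).
    by field; rewrite gt_eqF.
  by rewrite /y1 /t; lra.
have Z2 : y1 * (T * d2) <= w / 64.
  rewrite /w ler_pdivlMr // mulrAC ler_pdivlMr //.
  by have := ler_wpM2l (ltW beta0) hA; rewrite /y1; lra.
have Z3 : y2 * (T * d2) <= c / 64.
  have P1 : 0 <= c / mu by rewrite divr_ge0 // ltW.
  have := ler_wpM2l P1 hA; rewrite divfK ?gt_eqF // /y2; lra.
have Z4 : c * b * (3 * beta ^+ 2 * k3) <= 3 / 16 * c.
  by have := ler_wpM2l (ltW c0) h3; lra.
have Y1 : c * b * (3 * beta ^+ 2 * k2) <= 3 / 2 * y2.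
  have P1 : 0 <= c * (beta / mu) * b.
    by apply: mulr_ge0; [apply: mulr_ge0; apply: ltW|apply: ltW].
  have := ler_wpM2l P1 h2.
  have -> : c * (beta / mu) * b * (2 * beta * mu * k2) = 2 * (c * b * (beta ^+ 2 * k2)).
    by field; rewrite gt_eqF.
  by rewrite /y2; lra.
pose eps := Num.min (beta * mu / 2) (Num.min (w / 16) (e / 2)).
have eX : eps <= beta * mu / 2 by rewrite ge_min lexx.
have eZ : eps <= w / 16 by rewrite !ge_min lexx orbT.
have eY : eps <= e / 2 by rewrite !ge_min lexx !orbT.
have bm : 0 < beta * mu by rewrite mulr_gt0.
have eps0 : 0 < eps by rewrite !lt_min; apply/and3P; split; lra.
exists a, c, eps; split=> //; first by rewrite /a; lra.
  exact: ltW.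
move=> X Y Z VE VP VX VE' VP' VX' D X0 Y0 Z0 HE HP HX HD.
have a0 : 0 <= a by rewrite /a; lra.
have HP' := ler_wpM2l a0 HP.
have HX' := ler_wpM2l (ltW c0) HX.
have cb0 : 0 <= c * b by rewrite mulr_ge0 // ltW.
have HD' := ler_wpM2l cb0 HD.
(* In units of beta mu: -3/2 + 11/32 + 3/8 + 1/2 < 0. *)
have CX : - (3 / 2 * beta * mu) + y1 * (11 * T * ns) + c * b * (3 * beta ^+ 2 * kap)
    + eps <= 0 by lra.
(* After the losses c/16 and 3 c/16, a quarter of c is left of c/2, that is 4 t + w/4; it outweighs
   (2 + 11/32) t and 3 w/16. *)
have CZ : 2 * t + y1 * (11 * T) + a * (T * d2) - c / 2 + c * b * (3 * beta ^+ 2 * k3)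
    + eps <= 0.
  have -> : a * (T * d2) = 4 * (y1 * (T * d2)) + 4 * (y2 * (T * d2)) + e * (T * d2).
    by rewrite /a; ring.
  have cE : c = 16 * t + w by [].
  clearbody c; lra.
have CY : 3 / 2 * y1 - a / 2 + c * b * (3 * beta ^+ 2 * k2) + eps <= 0.
  by rewrite /a; lra.
have := ler_wpM2r X0 CX; have := ler_wpM2r Y0 CY; have := ler_wpM2r Z0 CZ.
rewrite !mul0r.
have E1 : 2 * beta / mu * ns * T * Z = 2 * t * Z by rewrite /t; ring.
rewrite E1 -/y1 in HE.
lra.
Qed.

End Decay.

(** * Step size *)

Lemma quotient_bound_le (R : realType) (beta num den : R) : 0 <= num -> 0 <= den ->
  (beta%:E <= quotient_bound num den)%E -> beta * den <= num.
Proof.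
move=> n0 d0; rewrite /quotient_bound; case: eqVneq => [->|dn]; first by rewrite mulr0.
by rewrite lee_fin ler_pdivlMr // lt_neqAle eq_sym dn.
Qed.

Section Constants.
Context {R : realType} {N : nat} {n : 'I_N -> nat}.
Local Notation ns := (nsum n).
Variables (f : 'I_ns -> 'cV[R]_ns -> R) (l : 'I_ns -> R) (mu : R).
Variables (edge : rel 'I_ns) (C Wc : forall i, 'M[R]_(n i)).
Variables (W : 'M[R]_ns) (WM : 'M[R]_(ns * ns)) (beta : R).
Hypotheses (N_gt0 : (0 < N)%N) (n_gt0 : forall i, (0 < n i)%N).
Hypothesis f_diff : forall a x, differentiable (f a) x.
Hypothesis f_lip : forall a, euclidean_lipschitz (l a) (gradient (f a)).
Hypotheses (mu_gt0 : 0 < mu) (P_mono : strongly_monotone mu (pseudo_gradient f)).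
Hypothesis edge_sym : symmetric edge.
Hypothesis Wc_lyap : forall i, lyapunov_solution (Cbar (C i)) (Wc i).
Hypothesis W_weights : observer_weights edge W.
Hypothesis WM_lyap : lyapunov_solution (observer_mx edge W) WM.
Hypothesis beta_gt0 : 0 < beta.
Hypothesis beta_le : (beta%:E <= step_bound edge l mu C Wc W WM)%E.

Local Notation L i := (laplacian edge i : 'M[R]_(n i)).
Local Notation D i := (laplacian_rows edge i : 'M[R]_(n i, n i * n i)).
Local Notation K i := (@Ibar R N n i).
Local Notation M := (observer_mx edge W).
Local Notation tr i := (tracking_gain C Wc i).
Local Notation b := (gamma_b edge W WM).

Definition rows_gain : R := \big[Num.max/0]_i ((n i)%:R * opnorm (D i) ^+ 2).
Definition lip_gain : R :=
  \big[Num.max/0]_i \big[Num.max/0]_(j < n i) (tr i * l (agent i j) ^+ 2).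
Definition lip_laplacian : R :=
  \big[Num.max/0]_i ((n i)%:R^-1 * lip_sqsum l i * opnorm (L i) ^+ 2).
(** [cross_gain], [observed_gain] and [state_gain] are the coefficients of the squared tracking,
    estimation and decision errors in [decision_increment]. *)
Definition cross_gain : R := \big[Num.max/0]_i opnorm (L i *m D i) ^+ 2.
Definition observed_gain : R :=
  \big[Num.max/0]_i (opnorm (L i) ^+ 4 * lip_sqsum l i / (n i)%:R ^+ 2).
Definition state_gain : R :=
  \sum_i (opnorm (L i) ^+ 4 / (n i)%:R ^+ 2 * lip_sum l i ^+ 2).

Local Notation g := rows_gain.
Local Notation T := lip_gain.
Local Notation S := lip_laplacian.
Local Notation d2 := (opnorm (1%:M - M) ^+ 2).

Lemma rows_gain_ge i : (n i)%:R * opnorm (D i) ^+ 2 <= g.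
Proof. exact: (le_bigmax 0 (fun i => (n i)%:R * opnorm (D i) ^+ 2)). Qed.

Lemma laplacian_gain_le i : opnorm (L i) ^+ 2 <= g.
Proof. apply: le_trans (rows_gain_ge i); exact: opnorm_laplacian_le. Qed.

Lemma lip_gain_ge i j : tr i * l (agent i j) ^+ 2 <= T.
Proof.
apply: (@le_trans _ _ (\big[Num.max/0]_(j < n i) (tr i * l (agent i j) ^+ 2))).
  exact: (le_bigmax 0 (fun j => tr i * l (agent i j) ^+ 2)).
exact: (le_bigmax 0 (fun i => \big[Num.max/0]_(j < n i) (tr i * l (agent i j) ^+ 2))).
Qed.

Lemma lip_laplacian_ge i : (n i)%:R^-1 * lip_sqsum l i * opnorm (L i) ^+ 2 <= S.
Proof. exact: (le_bigmax 0 (fun i => (n i)%:R^-1 * lip_sqsum l i * opnorm (L i) ^+ 2)). Qed.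

Lemma cross_gain_ge i : opnorm (L i *m D i) ^+ 2 <= cross_gain.
Proof. exact: (le_bigmax 0 (fun i => opnorm (L i *m D i) ^+ 2)). Qed.

Lemma observed_gain_ge i :
  opnorm (L i) ^+ 4 * lip_sqsum l i / (n i)%:R ^+ 2 <= observed_gain.
Proof.
exact: (le_bigmax 0 (fun i => opnorm (L i) ^+ 4 * lip_sqsum l i / (n i)%:R ^+ 2)).
Qed.

Lemma rows_gain_ge0 : 0 <= g. Proof. exact: bigmax_ge_id. Qed.
Lemma lip_gain_ge0 : 0 <= T. Proof. exact: bigmax_ge_id. Qed.
Lemma lip_laplacian_ge0 : 0 <= S. Proof. exact: bigmax_ge_id. Qed.
Lemma cross_gain_ge0 : 0 <= cross_gain. Proof. exact: bigmax_ge_id. Qed.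
Lemma observed_gain_ge0 : 0 <= observed_gain. Proof. exact: bigmax_ge_id. Qed.

Lemma tracking_gainE i : tr i = input_gain (Cbar (C i)) (Wc i) (K i).
Proof. by []. Qed.

Lemma tracking_gain_ge0 i : 0 <= tr i.
Proof. exact: input_gain_ge0. Qed.

Lemma tracking_lip_sqsum i : tr i * lip_sqsum l i <= (n i)%:R * T.
Proof.
rewrite mulr_sumr mulr_natl -[X in _ *+ X]card_ord -sumr_const.
by apply: ler_sum => j _; exact: lip_gain_ge.
Qed.

Lemma size_le_nsum i : (n i)%:R <= ns%:R :> R.
Proof. by rewrite ler_nat (bigD1 i) //= leq_addr. Qed.

Lemma coalitions_le_nsum : N%:R <= ns%:R :> R.
Proof.
rewrite ler_nat -[X in (X <= _)%N]card_ord -sum1_card; exact: leq_sum.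
Qed.

Lemma nsum_ge1 : 1 <= ns%:R :> R.
Proof. by apply: le_trans coalitions_le_nsum; rewrite ler1n. Qed.

Lemma nsum_gt0 : (0 < ns)%N.
Proof. by have := nsum_ge1; rewrite ler1n. Qed.

(** If every centering matrix is zero, all tracking gains vanish. Otherwise strong monotonicity is
    tested on a nonzero centered move w of one coalition: mu |w|^2 <= w^T K r, where r is the
    resulting change of its gradient block and |K r|^2 <= n^2 T |w|^2 by [sq_input_gain]. *)
Lemma mu_lip_gain : T = 0 \/ mu ^+ 2 <= ns%:R ^+ 2 * T.
Proof.
case: (boolP [forall i, K i == 0]) => [/forallP K0|nK]; [left|right].
  apply/eqP; rewrite eq_le lip_gain_ge0 andbT.
  apply: bigmax_le => // i _; apply: bigmax_le => // j _.
  suff -> : tr i = 0 by rewrite mul0r.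
  have op0 p q : opnorm (0 : 'M[R]_(p, q)) ^+ 2 = 0.
    apply/eqP; rewrite eq_le sqr_ge0 andbT; apply: opnorm_le_bound => // v.
    by rewrite mul0mx dot0l mul0r.
  rewrite /tracking_gain (eqP (K0 i)) !mulmx0 op0 mulr0 add0r.
  by apply/eqP; rewrite -sqrf_eq0 op0.
move: nK; rewrite negb_forall => /existsP[i Ki].
have [c wc] : exists c, col c (K i) != 0.
  apply/existsP; apply: contraNT Ki; rewrite negb_exists => /forallP H.
  apply/eqP/matrixP => a c; have := H c; rewrite negbK => /eqP/colP/(_ a).
  by rewrite mxE => ->; rewrite !mxE.
set w := col c (K i); have ww : 0 < dot w w by rewrite sq_gt0.
have Kw : K i *m w = w by rewrite /w -col_mul centered_idem.
have K_sym : (K i)^T = K i by rewrite /Ibar linearB /= trmx1 averaging_tr.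
have := P_mono (deviate 0 w) 0; rewrite enorm_sq subr0 !dot_deviate0 submxcol_deviate.
set r := submxcol _ i => H.
have rb : dot r r <= lip_sqsum l i * ((n i)%:R * dot w w).
  have := sample_lip f_lip (submxcol_pseudo_gradientB f_diff i (deviate 0 w) 0).
  rewrite subr0 sumr_const card_ord -[_ *+ n i]mulr_natl.
  by rewrite dot_deviate0 submxcol_deviate.
have Kr : dot (K i *m r) (K i *m r) <= (n i)%:R ^+ 2 * T * dot w w.
  apply: le_trans (sq_input_gain _ (Wc_lyap i) r) _; rewrite -tracking_gainE.
  have := ler_wpM2l (tracking_gain_ge0 i) rb.
  have nw : 0 <= (n i)%:R * dot w w by rewrite mulr_ge0 // ltW.
  have := ler_wpM2r nw (tracking_lip_sqsum i); lra.
have wr : dot w r = dot w (K i *m r) by rewrite dot_mul K_sym Kw.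
have : (mu * dot w w) ^+ 2 <= ((n i)%:R ^+ 2 * T) * (dot w w) ^+ 2.
  apply: (@le_trans _ _ (dot w r ^+ 2)).
    by rewrite ler_pXn2r ?nnegrE // ?(le_trans _ H) // mulr_ge0 // ltW.
  rewrite wr; apply: le_trans (cauchy_sq _ _) _.
  by have := ler_wpM2l (ltW ww) Kr; lra.
rewrite exprMn ler_pM2r ?exprn_gt0 // => /le_trans; apply.
rewrite ler_wpM2r ?lip_gain_ge0 // ler_pXn2r ?nnegrE ?ler0n //; exact: size_le_nsum.
Qed.

Lemma gamma_bE : b = ns%:R * input_gain M WM 1%:M.
Proof. by rewrite observer_input_gain. Qed.

Lemma gamma_b_ge : ns%:R <= b.
Proof.
by rewrite gamma_bE ler_peMr //; apply: observer_input_gain_ge1 => //; exact: nsum_gt0.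
Qed.

Lemma gamma_b_norm : ns%:R ^+ 2 <= 2 * (d2 * b).
Proof.
have h := observer_gain_norm W_weights WM_lyap nsum_gt0.
have := ler_wpM2l (ler0n R ns) h; rewrite gamma_bE; lra.
Qed.

Lemma gamma_xiE : gamma_xi edge l C Wc W = 4 * (S + 8 * g * T * d2).
Proof. by rewrite /gamma_xi /gamma_psi -/g -/S -/T; ring. Qed.

(** All terms of the first denominator are nonnegative, so the two summands 4 S and 32 g T d2 of
    [gamma_xi] can be bounded separately. *)
Lemma step_bound_lip :
  64 * beta * (g * T) * (d2 * b) <= mu /\ 8 * beta * S * b <= mu.
Proof.
have g0 := rows_gain_ge0; have T0 := lip_gain_ge0; have S0 := lip_laplacian_ge0.
have b0 : 0 <= b by apply: le_trans gamma_b_ge.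
have gTdb : 0 <= g * T * (d2 * b) :=
  mulr_ge0 (mulr_ge0 g0 T0) (mulr_ge0 (sqr_ge0 _) b0).
have Sb : 0 <= S * b by rewrite mulr_ge0.
have L0 : 0 <= \sum_i (lip_sum l i ^+ 2 * opnorm (L i) ^+ 2 / (n i)%:R).
  by apply: sumr_ge0 => i _; rewrite divr_ge0 // mulr_ge0 ?sqr_ge0.
move: beta_le; rewrite le_min => /andP[/quotient_bound_le H _].
have {}H := H (ltW mu_gt0); rewrite gamma_xiE in H.
set s := \sum_i _ in L0 H.
have den0 : 0 <= 2 * (s + 4 * (S + 8 * g * T * d2) * b) by lra.
have := H den0.
have := ler_wpM2l (ltW beta_gt0) gTdb; have := ler_wpM2l (ltW beta_gt0) Sb.
have := ler_wpM2l (ltW beta_gt0) L0.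
split; lra.
Qed.

Lemma step_bound_cross : 2 * beta * mu * cross_gain <= g.
Proof.
move: beta_le; rewrite !le_min => /and3P[_ H _].
have := quotient_bound_le _ _ H; rewrite /gamma_psi -/g -/cross_gain.
have g0 := rows_gain_ge0; have c0 := mulr_ge0 (ltW mu_gt0) cross_gain_ge0.
by move=> /(_ ltac:(lra) ltac:(lra)); lra.
Qed.

(** The third quotient, multiplied by beta b, gives 8 beta^2 mu b [observed_gain] <= beta b
    [gamma_xi]; by the first quotient the right side is at most mu/2. *)
Lemma step_bound_observed : 16 * beta ^+ 2 * (observed_gain * b) <= 1.
Proof.
move: beta_le; rewrite !le_min => /and3P[H1 _ H3].
have g0 := rows_gain_ge0; have T0 := lip_gain_ge0; have S0 := lip_laplacian_ge0.
have b0 : 0 <= b by apply: le_trans gamma_b_ge.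
have k0 := mulr_ge0 (ltW mu_gt0) observed_gain_ge0.
have x0 : 0 <= gamma_xi edge l C Wc W.
  have : 0 <= g * T * d2 := mulr_ge0 (mulr_ge0 g0 T0) (sqr_ge0 _).
  by rewrite gamma_xiE; lra.
have L0 : 0 <= \sum_i (lip_sum l i ^+ 2 * opnorm (L i) ^+ 2 / (n i)%:R).
  by apply: sumr_ge0 => i _; rewrite divr_ge0 // mulr_ge0 ?sqr_ge0.
have xb := mulr_ge0 x0 b0.
have := quotient_bound_le (ltW mu_gt0) _ H1; set s := \sum_i _ in L0 *.
move=> /(_ ltac:(lra)) {}H1.
have := quotient_bound_le x0 _ H3; rewrite -/observed_gain.
move=> /(_ ltac:(lra)) {}H3.
have h1 := ler_wpM2l (mulr_ge0 (ltW beta_gt0) b0) H3.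
have h2 := ler_wpM2l (ltW beta_gt0) L0.
by rewrite -(ler_pM2l mu_gt0); lra.
Qed.

Lemma step_bound_nsum : 32 * beta * ns%:R ^+ 2 * (g * T) <= mu.
Proof.
have [h _] := step_bound_lip; apply: le_trans h.
have gT : 0 <= beta * (g * T).
  by rewrite mulr_ge0 ?mulr_ge0 ?rows_gain_ge0 ?lip_gain_ge0 // ltW.
by have := ler_wpM2l gT gamma_b_norm; lra.
Qed.

(** Unless T = 0, mu^2 <= nsum^2 T; multiplied by beta g T, this reduces the claim to T times
    [step_bound_nsum]. *)
Lemma step_bound_mu : beta * mu * (g * T) <= T / 32.
Proof.
case: mu_lip_gain => [->|h]; first by rewrite !mulr0 mul0r.
have g0 := rows_gain_ge0; have T0 := lip_gain_ge0.
have h1 := ler_wpM2l (mulr_ge0 (mulr_ge0 (ltW beta_gt0) g0) T0) h.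
have h2 := ler_wpM2l T0 step_bound_nsum.
by rewrite -(ler_pM2l mu_gt0); lra.
Qed.

Lemma lip_sum_sq i : lip_sum l i ^+ 2 <= (n i)%:R * lip_sqsum l i.
Proof.
have := cauchy_sum (index_enum 'I_(n i)) (fun j => l (agent i j)) (fun=> 1).
under eq_bigr do rewrite mulr1.
under [X in _ * X]eq_bigr do rewrite expr1n.
by rewrite sumr_const card_ord mulrC.
Qed.

(** The fourth power of the Laplacian norm is shared: one square is bounded by [g], the other goes
    into [S]. *)
Lemma state_gain_lip : state_gain <= ns%:R * (g * S).
Proof.
have gS : 0 <= g * S by rewrite mulr_ge0 ?rows_gain_ge0 ?lip_laplacian_ge0.
apply: (@le_trans _ _ (N%:R * (g * S))); last first.
  by rewrite ler_wpM2r // coalitions_le_nsum.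
rewrite mulr_natl -[X in _ *+ X]card_ord -sumr_const; apply: ler_sum => i _.
have ni : (n i)%:R != 0 :> R by rewrite pnatr_eq0 -lt0n.
apply: (@le_trans _ _ (opnorm (L i) ^+ 2
    * ((n i)%:R^-1 * lip_sqsum l i * opnorm (L i) ^+ 2))).
  have c0 : 0 <= opnorm (L i) ^+ 4 / (n i)%:R ^+ 2 by rewrite divr_ge0 ?exprn_ge0 ?opnorm_ge0.
  apply: le_trans (ler_wpM2l c0 (lip_sum_sq i)) _.
  by rewrite le_eqVlt; apply/orP; left; apply/eqP; field.
apply: ler_pM; rewrite ?sqr_ge0 ?laplacian_gain_le ?lip_laplacian_ge //.
by rewrite mulr_ge0 ?sqr_ge0 // mulr_ge0 ?invr_ge0 ?ler0n ?lip_sqsum_ge0.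
Qed.

Lemma state_gain_observed : state_gain <= ns%:R * observed_gain.
Proof.
rewrite natr_sum mulr_suml; apply: ler_sum => i _.
have c0 : 0 <= opnorm (L i) ^+ 4 / (n i)%:R ^+ 2 by rewrite divr_ge0 ?exprn_ge0 ?opnorm_ge0.
apply: le_trans (ler_wpM2l c0 (lip_sum_sq i)) _.
by have := ler_wpM2l (ler0n R (n i)) (observed_gain_ge i); lra.
Qed.

Lemma state_gain_ge0 : 0 <= state_gain.
Proof.
by apply: sumr_ge0 => i _; rewrite mulr_ge0 ?sqr_ge0 // divr_ge0 ?exprn_ge0 ?opnorm_ge0.
Qed.

End Constants.

(** * The iteration *)

Section Dynamics.
Context {R : realType} {N : nat} {n : 'I_N -> nat}.
Local Notation ns := (nsum n).
Variables (f : 'I_ns -> 'cV[R]_ns -> R) (res : 'I_ns -> R).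
Variables (l : 'I_ns -> R) (mu : R) (edge : rel 'I_ns).
Variables (C Wc : forall i, 'M[R]_(n i)).
Variables (W : 'M[R]_ns) (WM : 'M[R]_(ns * ns)) (beta : R).
Variables (x eta : nat -> 'cV[R]_ns) (psi : nat -> forall i, 'M[R]_(n i)).
Variables (xi : nat -> 'I_ns -> 'cV[R]_ns).
Hypotheses (N_gt0 : (0 < N)%N) (n_gt0 : forall i, (0 < n i)%N).
Hypothesis f_diff : forall a y, differentiable (f a) y.
Hypothesis f_lip : forall a, euclidean_lipschitz (l a) (gradient (f a)).
Hypotheses (mu_gt0 : 0 < mu) (P_mono : strongly_monotone mu (pseudo_gradient f)).
Hypothesis graph : communication_graph edge.
Hypothesis C_weights : forall i, consensus_weights edge (C i).
Hypothesis Wc_lyap : forall i, lyapunov_solution (Cbar (C i)) (Wc i).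
Hypothesis W_weights : observer_weights edge W.
Hypothesis WM_lyap : lyapunov_solution (observer_mx edge W) WM.
Hypothesis beta_gt0 : 0 < beta.
Hypothesis run : algorithm f res edge C W beta x eta psi xi.

Local Notation P := (pseudo_gradient f).
Local Notation L i := (laplacian edge i : 'M[R]_(n i)).
Local Notation D i := (laplacian_rows edge i : 'M[R]_(n i, n i * n i)).
Local Notation K i := (@Ibar R N n i).
Local Notation M := (observer_mx edge W).
Local Notation one i := (const_mx 1 : 'cV[R]_(n i)).

Let edge_sym : symmetric edge. Proof. by case: graph. Qed.

Let L_sym i : (L i)^T = L i. Proof. exact: laplacian_sym. Qed.

Let LJ i : L i *m averaging_mx (n i) = 0. Proof. exact: laplacian_averaging. Qed.

Let LJ_unit i : L i + averaging_mx (n i) \in unitmx.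
Proof. by apply: laplacian_averaging_unit => //; case: graph. Qed.

Let D_vec i (G : 'M[R]_(n i)) : D i *m vec G = \col_j \sum_k L i j k * G j k.
Proof. exact: laplacian_rows_vec. Qed.

Lemma decision_etaE k i :
  submxcol (x k) i = submxcol (x 0%N) i - L i *m submxcol (eta k) i.
Proof.
have [_ xE _ _ _] := run; apply/colP => j; rewrite submxcolE xE.
rewrite [RHS]mxE [X in _ = _ + X]mxE laplacian_mulE !submxcolE; congr (_ - _).
by apply: eq_bigr => m _; rewrite !submxcolE.
Qed.

Lemma eta_step k i :
  submxcol (eta k.+1) i = submxcol (eta k) i + beta *: (D i *m vec (psi k i)).
Proof.
have [_ _ etaE _ _] := run; apply/colP => j; rewrite submxcolE etaE D_vec.
rewrite [RHS]mxE submxcolE; congr (_ + _); rewrite mxE; congr (_ * _).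
by rewrite mxE (laplacian_sumE edge j (psi k i j)).
Qed.

Lemma decision_step k i :
  submxcol (x k.+1) i
  = submxcol (x k) i - beta *: (L i *m (D i *m vec (psi k i))).
Proof.
by rewrite (decision_etaE k.+1) (decision_etaE k) eta_step mulmxDr -scalemxAr opprD addrA.
Qed.

(** The decisions differ from the initial ones by a vector in the range of a Laplacian, whose
    entries sum to zero. *)
Lemma decision_feasible k i : \sum_(j < n i) x k (agent i j) 0 = coalition_resource res i.
Proof.
have [[x0 _ _] _ _ _ _] := run.
transitivity (\sum_j (submxcol (x 0%N) i j 0 - (L i *m submxcol (eta k) i) j 0)).
  apply: eq_bigr => j _; rewrite -submxcolE decision_etaE.
  by rewrite [LHS]mxE [X in _ + X]mxE.
rewrite sumrB [X in _ - X](_ : _ = 0) ?subr0.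
  by apply: eq_bigr => j _; rewrite submxcolE x0.
have : averaging_mx (n i) *m (L i *m submxcol (eta k) i) = 0.
  by rewrite mulmxA averaging_mulL // mul0mx.
move/colP/(_ (Ordinal (n_gt0 i))); rewrite averaging_mulE [RHS]mxE => /eqP.
by rewrite mulf_eq0 invr_eq0 pnatr_eq0 eqn0Ngt n_gt0 => /eqP.
Qed.

Variable xs : 'cV[R]_ns.
Hypotheses (fxs : forall i, feasible res (submxcol xs i)) (Sxs : stationary f xs).

Definition sample k i : 'M[R]_(n i) := \matrix_(j, c)
  (partial (agent i c) (f (agent i j)) (xi k (agent i j))
   - partial (agent i c) (f (agent i j)) xs).

Lemma sample_row k i j : (row j (sample k i))^T
  = submxcol (gradient (f (agent i j)) (xi k (agent i j)) - gradient (f (agent i j)) xs) i.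
Proof. by apply/colP => c; rewrite !mxE. Qed.

Lemma sample_diff_row k i j : (row j (sample k.+1 i - sample k i))^T
  = submxcol (gradient (f (agent i j)) (xi k.+1 (agent i j))
              - gradient (f (agent i j)) (xi k (agent i j))) i.
Proof. by apply/colP => c; rewrite !mxE; ring. Qed.

Lemma psi_step k i : psi k.+1 i = C i *m psi k i + (sample k.+1 i - sample k i).
Proof.
have [_ _ _ psiE _] := run; have [_ C0 _ _] := C_weights i.
apply/matrixP => j c; rewrite psiE [RHS]mxE -addrA; congr (_ + _).
  rewrite mxE big_mkcond; apply: eq_bigr => m _.
  by case: ifP => // /negbT /C0 ->; rewrite mul0r.
by rewrite !mxE; ring.
Qed.

(** The invariant of gradient tracking: [C i] has unit column sums, so mixing preserves the sum over
    the members, which stays the sum of their current gradients. *)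
Lemma psi_colsum k i : (psi k i)^T *m one i
  = (sample k i)^T *m one i + submxcol (P xs) i.
Proof.
elim: k => [|k IH].
  have [[_ _ psi0] _ _ _ _] := run.
  rewrite submxcol_pseudo_gradient // submxcol_sum !trmx_mul_const1 -big_split /=.
  apply: eq_bigr => j _; apply/colP => c.
  by rewrite mxE [LHS]mxE psi0 !mxE; ring.
have [_ _ _ C1] := C_weights i.
have Ct : (C i)^T *m one i = one i.
  apply/colP => c; rewrite !mxE -[RHS](C1 c).
  by apply: eq_bigr => j _; rewrite !mxE mulr1.
rewrite psi_step linearD /= trmx_mul mulmxDl -mulmxA Ct IH linearB /= mulmxBl.
by rewrite addrC addrA subrK.
Qed.

(** The pseudo-gradient block at [xs] is constant, so the Laplacian removes it. *)
Lemma laplacian_psi_colsum k i :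
  L i *m ((psi k i)^T *m one i) = L i *m ((sample k i)^T *m one i).
Proof.
rewrite psi_colsum mulmxDr -[X in X *m submxcol (P xs) i](L_centered (LJ i)).
by rewrite -mulmxA Sxs mulmx0 addr0.
Qed.

Lemma tracker_step k i : K i *m psi k.+1 i
  = Cbar (C i) *m (K i *m psi k i) + K i *m (sample k.+1 i - sample k i).
Proof.
have [_ _ C1 C2] := C_weights i.
by rewrite psi_step mulmxDr !mulmxA centered_mulC // mulA_centered.
Qed.

Definition estimate_error k : 'M[R]_ns := \matrix_(a, c) (xi k a c 0 - x k c 0).

Lemma estimate_error_row k a : (row a (estimate_error k))^T = xi k a - x k.
Proof. by apply/colP => c; rewrite !mxE. Qed.

(** The weights of an update sum to 1, so errors relative to [x k] evolve by [M]. The new error is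
    measured from [x k.+1], whence the increment as input. *)
Lemma estimate_error_step k :
  vec (estimate_error k.+1) = M *m vec (estimate_error k)
    + 1%:M *m vec (\matrix_(a, c) (x k - x k.+1) c 0 : 'M[R]_ns).
Proof.
have [_ _ _ _ xiE] := run.
rewrite mul1mx observer_mulE -vecD; congr vec; apply/matrixP => a c.
rewrite mxE xiE (sum_neighbors W_weights a (fun d => xi k d c 0)).
rewrite [RHS]mxE [X in _ = X + _]mxE [X in _ = X + _ + _]mxE.
have -> : \sum_j W a j * estimate_error k j c
    = \sum_d W a d * xi k d c 0 - (\sum_d W a d) * x k c 0.
  by rewrite mulr_suml -sumrB; apply: eq_bigr => d _; rewrite mxE mulrBr.
by rewrite !mxE (wbarE W_weights); ring.
Qed.

Lemma frob_rows_const m p (v : 'cV[R]_p) :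
  frob (\matrix_(a < m, c < p) v c 0) = m%:R * dot v v.
Proof.
rewrite frob_row mulr_natl -[X in _ *+ X]card_ord -sumr_const.
apply: eq_bigr => a _; congr dot; apply/colP => c; by rewrite !mxE.
Qed.

Lemma estimate_increments k :
  \sum_a dot (xi k.+1 a - xi k a) (xi k.+1 a - xi k a)
  <= opnorm (1%:M - M) ^+ 2 * frob (estimate_error k).
Proof.
rewrite -sq_vec; apply: le_trans (opnorm_sq _ _).
pose Z : 'M[R]_ns := \matrix_(a, c) (xi k a c 0 - xi k.+1 a c 0).
have -> : (1%:M - M) *m vec (estimate_error k) = vec Z.
  rewrite mulmxBl mul1mx; set d : 'M[R]_ns := \matrix_(a, c) (x k - x k.+1) c 0.
  have -> : M *m vec (estimate_error k) = vec (estimate_error k.+1) - vec d.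
    by rewrite estimate_error_step mul1mx addrK.
  by apply/colP => q; rewrite !mxE; ring.
rewrite sq_vec frob_row le_eqVlt; apply/orP; left; apply/eqP/eq_bigr => a _.
by rewrite -sqN; congr dot; apply/colP => c; rewrite !mxE; ring.
Qed.

Local Notation errX k := (dot (x k - xs) (x k - xs)).
Local Notation Psi k i := (K i *m psi k i).
Local Notation u k i := (submxcol (x k - xs) i).
Local Notation errY k := (\sum_i frob (Psi k i)).
Local Notation errZ k := (frob (estimate_error k)).
Local Notation errZi k i :=
  (\sum_j dot (xi k (agent i j) - x k) (xi k (agent i j) - x k)).
Local Notation tr i := (tracking_gain C Wc i).
Local Notation g := (rows_gain edge : R).
Local Notation T := (lip_gain l C Wc).

Definition decision_energy k : R :=
  \sum_i state_energy (L i) (C i) (D i) beta (u k i) (sample k i) (Psi k i).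
Definition consensus_energy k : R := \sum_i tracker_energy (Wc i) (Psi k i).
Definition observer_energy k : R :=
  dot (vec (estimate_error k)) (WM *m vec (estimate_error k)).

Lemma sum_estimate_blocks k : \sum_i errZi k i = errZ k.
Proof.
rewrite frob_row (sum_agents (fun a => dot (row a (estimate_error k))^T (row a (estimate_error k))^T)).
by apply: eq_bigr => i _; apply: eq_bigr => j _; rewrite estimate_error_row.
Qed.

Lemma sample_block_le k i :
  \sum_j dot (xi k (agent i j) - xs) (xi k (agent i j) - xs)
  <= 2 * (errZi k i + (n i)%:R * errX k).
Proof.
rewrite mulrDr mulr_sumr [(n i)%:R * _]mulr_natl.
rewrite -[X in errX k *+ X]card_ord -sumr_const mulr_sumr -big_split /=.
apply: ler_sum => j _; have -> : xi k (agent i j) - xs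
    = (xi k (agent i j) - x k) + (x k - xs) by rewrite addrA subrK.
exact: sqD_le2.
Qed.

Lemma frob_sample_le k i : frob (sample k i)
  <= \sum_j l (agent i j) ^+ 2
       * dot (xi k (agent i j) - xs) (xi k (agent i j) - xs).
Proof.
rewrite frob_row; apply: ler_sum => j _; rewrite sample_row.
apply: le_trans (sq_block_le _ _) _; exact: gradient_lip_sq.
Qed.

Lemma sample_split k i : (sample k i)^T *m one i
  = submxcol (P (x k) - P xs) i
    + \sum_j submxcol (gradient (f (agent i j)) (xi k (agent i j))
                       - gradient (f (agent i j)) (x k)) i.
Proof.
rewrite submxcol_pseudo_gradientB // trmx_mul_const1 -big_split /=.
apply: eq_bigr => j _; rewrite sample_row -submxcolD; congr (submxcol _ i).
by rewrite [RHS]addrC addrA subrK.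
Qed.

Lemma decision_centered k i : averaging_mx (n i) *m u k i = 0.
Proof.
apply: averaging_eq0; rewrite submxcolB.
by apply: (feasible_sub (res := res)) => //; rewrite /feasible -(decision_feasible k);
  apply: eq_bigr => j _; rewrite submxcolE.
Qed.

(** Sums [state_energy_step] over the coalitions, its [b] being T times the squared distances of the
    estimates to [xs]. Strong monotonicity yields -2 beta mu on the decision error; a quarter of it
    is spent on the estimation errors. *)
Lemma decision_energy_step k :
  decision_energy k.+1 <= decision_energy k - 3 / 2 * beta * mu * errX k
    + 2 * beta / mu * ns%:R * T * errZ k
    + beta ^+ 2 * g * (11 * T * (errZ k + ns%:R * errX k) + 3 / 2 * errY k).
Proof.
have T0 : 0 <= T := lip_gain_ge0 _ _ _.
have g0 : 0 <= g := rows_gain_ge0 _.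
have X0 := sq_ge0 (x k - xs).
pose p i := submxcol (P (x k) - P xs) i.
have block i : state_energy (L i) (C i) (D i) beta (u k.+1 i) (sample k.+1 i) (Psi k.+1 i)
  <= state_energy (L i) (C i) (D i) beta (u k i) (sample k i) (Psi k i)
     - 2 * beta * dot (u k i) (p i) + beta * mu / 2 * dot (u k i) (u k i)
     + 2 * beta / mu * ns%:R * T * errZi k i
     + beta ^+ 2 * g * (11 * T * (errZi k i + (n i)%:R * errX k) + 3 / 2 * frob (Psi k i)).
  set Q := \sum_j dot (xi k (agent i j) - xs) (xi k (agent i j) - xs).
  have Q0 : 0 <= Q by apply: sumr_ge0 => j _; exact: sq_ge0.
  have QZ := sample_block_le k i; rewrite -/Q in QZ.
  have trG : tr i * frob (sample k i) <= T * Q.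
    apply: le_trans (ler_wpM2l (tracking_gain_ge0 _ _ _) (frob_sample_le k i)) _.
    rewrite /Q !mulr_sumr; apply: ler_sum => j _.
    by rewrite mulrA ler_wpM2r ?sq_ge0 // lip_gain_ge.
  have trh : tr i * dot ((sample k i)^T *m one i) ((sample k i)^T *m one i)
      <= (n i)%:R * (T * Q).
    have hE : (sample k i)^T *m one i = \sum_j submxcol
        (gradient (f (agent i j)) (xi k (agent i j)) - gradient (f (agent i j)) xs) i.
      by rewrite trmx_mul_const1; apply: eq_bigr => j _; rewrite sample_row.
    apply: le_trans (ler_wpM2l (tracking_gain_ge0 _ _ _) (sample_lip f_lip hE)) _.
    by rewrite !mulrA ler_wpM2r // tracking_lip_sqsum.
  have uE : u k.+1 i = u k i - beta *: (L i *m (D i *m vec (psi k i))).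
    by rewrite !submxcolB decision_step addrAC.
  have H := state_energy_step (n_gt0 i) (L_sym i) (LJ i) (LJ_unit i) (@D_vec i)
    (Wc_lyap i) (decision_centered k i) (tracker_step k i) uE
    (laplacian_psi_colsum k i) (mulr_ge0 T0 Q0) trG trh g0
    (rows_gain_ge edge i) (laplacian_gain_le edge i).
  apply: le_trans H _; rewrite sample_split dotDr -/(p i); set de := \sum_j submxcol _ i.
  have ZQ : beta ^+ 2 * g * (11 / 2 * (T * Q))
      <= beta ^+ 2 * g * (11 * T * (errZi k i + (n i)%:R * errX k)).
    by apply: ler_wpM2l; [exact: mulr_ge0 (sqr_ge0 _) g0|have := ler_wpM2l T0 QZ; lra].
  have Kde : dot (K i *m de) (K i *m de) <= ns%:R * T * errZi k i.
    have Z0 : 0 <= errZi k i by apply: sumr_ge0 => j _; exact: sq_ge0.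
    apply: le_trans (sq_input_gain _ (Wc_lyap i) de) _; rewrite -tracking_gainE.
    apply: le_trans (ler_wpM2l (tracking_gain_ge0 _ _ _) (sample_lip f_lip (erefl de))) _.
    rewrite mulrA ler_wpM2r //; apply: le_trans (tracking_lip_sqsum _ _ _ _) _.
    by rewrite ler_wpM2r // size_le_nsum.
  have ude : dot (u k i) de = dot (u k i) (K i *m de).
    have K_sym : (K i)^T = K i by rewrite /Ibar linearB /= trmx1 averaging_tr.
    by rewrite dot_mul K_sym /Ibar mulmxBl mul1mx decision_centered subr0.
  (* Young's inequality, from |(mu/2) u + K de|^2 >= 0 scaled by 2 beta / mu. Centering [de] first
     is what brings in T. *)
  have yg : - (2 * beta * dot (u k i) de)
      <= beta * mu / 2 * dot (u k i) (u k i)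
         + 2 * beta / mu * (ns%:R * T * errZi k i).
    rewrite ude; have := sq_ge0 ((mu / 2) *: u k i + K i *m de).
    rewrite sqD sqZ dotZl => yg.
    have bm : 0 <= 2 * beta / mu by rewrite divr_ge0 ?mulr_ge0 // ltW.
    have := ler_wpM2l bm yg; have := ler_wpM2l bm Kde.
    have E1 : 2 * beta / mu * (mu / 2) ^+ 2 = beta * mu / 2 by field; rewrite gt_eqF.
    have E2 : 2 * beta / mu * (mu / 2) = beta by field; rewrite gt_eqF.
    have -> : 2 * beta / mu * ((mu / 2) ^+ 2 * dot (u k i) (u k i)
        + 2 * (mu / 2 * dot (u k i) (K i *m de)) + dot (K i *m de) (K i *m de))
      = 2 * beta / mu * (mu / 2) ^+ 2 * dot (u k i) (u k i)
        + 2 * (2 * beta / mu * (mu / 2)) * dot (u k i) (K i *m de)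
        + 2 * beta / mu * dot (K i *m de) (K i *m de) by ring.
    by rewrite E1 E2; lra.
  lra.
have mono := P_mono (x k) xs; rewrite enorm_sq in mono.
apply: le_trans (ler_sum _ (fun i _ => block i)) _.
rewrite !big_split /= sumrN -!mulr_sumr !big_split /= -!mulr_sumr big_split /=.
rewrite -mulr_suml -natr_sum sum_estimate_blocks -!dot_blocks -/(decision_energy k).
have := ler_wpM2l (ltW beta_gt0) mono; lra.
Qed.

(** The trackers are driven by gradient increments, hence by increments of the estimates, which
    [estimate_increments] bounds by the estimation errors. *)
Lemma consensus_energy_step k :
  consensus_energy k.+1 <= consensus_energy k - 2^-1 * errY k
    + T * opnorm (1%:M - M) ^+ 2 * errZ k.
Proof.
have T0 : 0 <= T := lip_gain_ge0 _ _ _.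
have block i : tracker_energy (Wc i) (Psi k.+1 i)
  <= tracker_energy (Wc i) (Psi k i) - 2^-1 * frob (Psi k i)
     + T * \sum_j dot (xi k.+1 (agent i j) - xi k (agent i j))
                      (xi k.+1 (agent i j) - xi k (agent i j)).
  apply: le_trans (tracker_energy_step (Wc_lyap i) (tracker_step k i)) _.
  rewrite lerD2l frob_row !mulr_sumr; apply: ler_sum => j _; rewrite sample_diff_row.
  apply: (@le_trans _ _ (tr i * (l (agent i j) ^+ 2
      * dot (xi k.+1 (agent i j) - xi k (agent i j))
            (xi k.+1 (agent i j) - xi k (agent i j))))).
    rewrite ler_wpM2l ?tracking_gain_ge0 //.
    by apply: le_trans (sq_block_le _ _) _; exact: gradient_lip_sq.
  by rewrite mulrA ler_wpM2r ?sq_ge0 // lip_gain_ge.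
apply: le_trans (ler_sum _ (fun i _ => block i)) _.
rewrite !big_split /= sumrN -!mulr_sumr -/(consensus_energy k) lerD2l.
have := estimate_increments k; rewrite sum_agents => H.
by have := ler_wpM2l T0 H; lra.
Qed.

Lemma observer_energy_step k :
  observer_energy k.+1 <= observer_energy k - 2^-1 * errZ k
    + gamma_b edge W WM * dot (x k - x k.+1) (x k - x k.+1).
Proof.
rewrite /observer_energy estimate_error_step.
apply: le_trans (lyapunov_step _ WM_lyap _ _) _.
rewrite !sq_vec frob_rows_const gamma_bE //.
by rewrite le_eqVlt; apply/orP; left; apply/eqP; ring.
Qed.

Lemma decision_increment k :
  dot (x k - x k.+1) (x k - x k.+1)
  <= 3 * beta ^+ 2 * (state_gain l edge * errX k + observed_gain l edge * errZ k
                      + cross_gain edge * errY k).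
Proof.
have X0 := sq_ge0 (x k - xs).
have block i : dot (submxcol (x k - x k.+1) i) (submxcol (x k - x k.+1) i)
  <= 3 * beta ^+ 2 * (opnorm (L i) ^+ 4 / (n i)%:R ^+ 2 * lip_sum l i ^+ 2 * errX k
      + observed_gain l edge * errZi k i + cross_gain edge * frob (Psi k i)).
  have -> : submxcol (x k - x k.+1) i = beta *: (L i *m (D i *m vec (psi k i))).
    by rewrite submxcolB decision_step opprB addrC subrK.
  rewrite sqZ [3 * beta ^+ 2]mulrC -[leRHS]mulrA; apply: ler_wpM2l; first exact: sqr_ge0.
  have := laplacian_psi_colsum k i; rewrite sample_split => colE.
  apply: le_trans (decision_move_le (@D_vec i) colE) _; rewrite ler_wpM2l //.
  have Z0 : 0 <= errZi k i by apply: sumr_ge0 => j _; exact: sq_ge0.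
  have c0 : 0 <= opnorm (L i) ^+ 4 / (n i)%:R ^+ 2.
    by rewrite divr_ge0 ?exprn_ge0 ?opnorm_ge0.
  apply: lerD; first apply: lerD.
  (* All members compare the same two points, so the triangle inequality gives [lip_sum]; the next
     part has distinct points and uses [sample_lip]. *)
  - rewrite -[leRHS]mulrA; apply: ler_wpM2l => //.
    rewrite submxcol_pseudo_gradientB // -!enorm_sq -exprMn.
    rewrite ler_pXn2r ?nnegrE ?enorm_ge0 //.
      apply: le_trans (enorm_sum _ _) _; rewrite mulr_suml; apply: ler_sum => j _.
      by apply: le_trans (f_lip _ _ _); rewrite ler_wsqrtr // sq_block_le.
    rewrite mulr_suml; apply: sumr_ge0 => j _.
    exact: le_trans (enorm_ge0 _) (f_lip _ _ _).
  - apply: le_trans (ler_wpM2l c0 (sample_lip f_lip erefl)) _.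
    rewrite mulrA ler_wpM2r //; apply: le_trans (observed_gain_ge l edge i).
    by rewrite mulrAC.
  - by rewrite ler_wpM2r ?frob_ge0 // cross_gain_ge.
rewrite dot_blocks; apply: le_trans (ler_sum _ (fun i _ => block i)) _.
rewrite -mulr_sumr !big_split /= -!mulr_sumr -mulr_suml sum_estimate_blocks.
exact: lexx.
Qed.

(** A crude constant is enough: it affects the rate of convergence but not the step size. *)
Lemma energies_bounded (a c : R) : 0 <= a -> 0 <= c -> exists2 B : R, 0 <= B &
  forall k, decision_energy k + a * consensus_energy k + c * observer_energy k
            <= B * (errX k + errY k + errZ k).
Proof.
move=> a0 c0.
pose q i := (n i)%:R * opnorm (invmx (L i + averaging_mx (n i))) ^+ 2
  * (2 + 8 * beta ^+ 2 * opnorm (L i *m D i) ^+ 2 * tr i).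
pose r i := q i * (1 + 2 * lip_sqsum l i * (1 + (n i)%:R)).
have q0 i : 0 <= q i.
  apply: mulr_ge0; first by rewrite mulr_ge0 ?sqr_ge0.
  rewrite addr_ge0 // mulr_ge0 ?tracking_gain_ge0 //.
  by rewrite mulr_ge0 ?sqr_ge0 // mulr_ge0 ?sqr_ge0.
have r0 i : 0 <= r i.
  by rewrite mulr_ge0 // addr_ge0 // mulr_ge0 ?addr_ge0 // mulr_ge0 ?lip_sqsum_ge0.
have p0 i : 0 <= opnorm (Wc i) by exact: opnorm_ge0.
exists (\sum_i r i + a * \sum_i opnorm (Wc i) + c * opnorm WM).
  by rewrite !addr_ge0 ?mulr_ge0 ?sumr_ge0 ?opnorm_ge0.
move=> k; have X0 := sq_ge0 (x k - xs).
have Z0 := frob_ge0 (estimate_error k).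
have Y0 : 0 <= errY k by apply: sumr_ge0 => i _; exact: frob_ge0.
have XYZ : 0 <= errX k + errY k + errZ k by lra.
have Yi i : frob (Psi k i) <= errY k.
  by rewrite (bigD1 i) //= lerDl sumr_ge0 // => j _; exact: frob_ge0.
have Zi0 i : 0 <= errZi k i by apply: sumr_ge0 => j _; exact: sq_ge0.
have ZiZ i : errZi k i <= errZ k.
  rewrite -sum_estimate_blocks [leRHS](bigD1 i) //= lerDl; apply: sumr_ge0 => j _.
  exact: Zi0.
rewrite !mulrDl; apply: lerD; first apply: lerD.
- rewrite mulr_suml; apply: ler_sum => i _.
  have KP : K i *m Psi k i = Psi k i by rewrite mulmxA centered_idem.
  apply: le_trans (state_energy_le _ _ _ (Wc_lyap i) _ _ KP) _.
  rewrite -/(q i) /r -[leRHS]mulrA; apply: ler_wpM2l => //.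
  have h1 := sq_block_le (x k - xs) i; have h2 := Yi i.
  have h3 : frob (sample k i) <= lip_sqsum l i * (2 * (errZ k + (n i)%:R * errX k)).
    apply: (@le_trans _ _ (lip_sqsum l i * (2 * (errZi k i + (n i)%:R * errX k)))).
      apply: le_trans (ler_wpM2l (lip_sqsum_ge0 _ _) (sample_block_le k i)).
      apply: le_trans (frob_sample_le k i) _.
      rewrite mulr_sumr; apply: ler_sum => j _; rewrite ler_wpM2r ?sq_ge0 //.
      by rewrite /lip_sqsum (bigD1 j) //= lerDl sumr_ge0 // => m _; rewrite sqr_ge0.
    by rewrite ler_wpM2l ?lip_sqsum_ge0 // ler_wpM2l // lerD2r.
  have l0 := lip_sqsum_ge0 l i; have n0 := ler0n R (n i).
  have h4 := mulr_ge0 l0 X0; have h5 := mulr_ge0 l0 Y0.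
  have h6 := mulr_ge0 (mulr_ge0 l0 n0) Y0; have h7 := mulr_ge0 (mulr_ge0 l0 n0) Z0.
  lra.
- rewrite -[leRHS]mulrA; apply: ler_wpM2l => //.
  rewrite mulr_suml; apply: ler_sum => i _.
  apply: le_trans (tracker_energy_le _ _) _; rewrite ler_wpM2l //.
  by have := Yi i; lra.
- rewrite -[leRHS]mulrA; apply: ler_wpM2l => //; apply: le_trans (opnorm_quad _ _) _.
  by rewrite sq_vec ler_wpM2l ?opnorm_ge0 //; lra.
Qed.

Hypothesis beta_le : (beta%:E <= step_bound edge l mu C Wc W WM)%E.

Lemma run_linear_convergence : linear_convergence x xs.
Proof.
have [hA hB] := step_bound_lip N_gt0 n_gt0 mu_gt0 WM_lyap beta_gt0 beta_le.
have [a [c [eps [a0 c0 eps0 step]]]] := weights_exist (nsum_ge1 N_gt0 n_gt0)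
  (gamma_b_ge N_gt0 n_gt0 WM_lyap) beta_gt0 mu_gt0 (rows_gain_ge0 edge)
  (lip_gain_ge0 l C Wc) (lip_laplacian_ge0 l edge) (sqr_ge0 (opnorm (1%:M - M)))
  (cross_gain_ge0 edge) (observed_gain_ge0 l edge) (state_gain_ge0 l edge) hA
  (step_bound_nsum N_gt0 n_gt0 mu_gt0 W_weights WM_lyap beta_gt0 beta_le) hB
  (step_bound_mu N_gt0 n_gt0 f_diff f_lip mu_gt0 P_mono Wc_lyap W_weights WM_lyap beta_gt0 beta_le)
  (step_bound_cross mu_gt0 beta_le)
  (step_bound_observed N_gt0 n_gt0 mu_gt0 WM_lyap beta_gt0 beta_le)
  (state_gain_lip l edge n_gt0) (state_gain_observed l edge).
have [B B0 up] := energies_bounded a0 c0.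
have X0 k : 0 <= errX k := sq_ge0 _.
have Y0 k : 0 <= errY k by apply: sumr_ge0 => i _; exact: frob_ge0.
have Z0 k : 0 <= errZ k := frob_ge0 _.
pose V k := decision_energy k + a * consensus_energy k + c * observer_energy k.
have V0 k : 0 <= V k.
  apply: addr_ge0; first apply: addr_ge0.
  - by apply: sumr_ge0 => i _; exact: state_energy_ge0.
  - by rewrite mulr_ge0 // sumr_ge0 // => i _; exact: tracker_energy_ge0 (Wc_lyap i) _.
  - by rewrite mulr_ge0 //; exact: lyapunov_ge0 WM_lyap _.
have decr k : V k.+1 <= V k - eps * (errX k + errY k + errZ k).
  exact: step (X0 k) (Y0 k) (Z0 k) (decision_energy_step k) (consensus_energy_step k)
    (observer_energy_step k) (decision_increment k).
have S0 k : 0 <= errX k + errY k + errZ k by rewrite !addr_ge0.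
have [B' [q [B'0 /andP[q0 q1] H]]] := energy_decay eps0 B0 V0 S0 decr up.
(* The decay concerns squared errors, hence the square roots. *)
exists (Num.sqrt B'), (Num.sqrt q); split=> [||k]; first by rewrite sqrtr_gt0.
  by rewrite sqrtr_gt0 q0 -[ltRHS]sqrtr1 ltr_sqrt ?ltr01.
apply: ler_sq; first by rewrite mulr_ge0 ?exprn_ge0 ?sqrtr_ge0.
rewrite enorm_sq exprMn exprAC (sqr_sqrtr (ltW B'0)) (sqr_sqrtr (ltW q0)).
by apply: le_trans (H k); have := Y0 k; have := Z0 k; lra.
Qed.

End Dynamics.

Theorem theorem2 (R : realType) (N : nat) (n : 'I_N -> nat)
    (N_gt0 : (0 < N)%N) (n_gt0 : forall i, (0 < n i)%N)
    (f : 'I_(nsum n) -> 'cV[R]_(nsum n) -> R) (res : 'I_(nsum n) -> R)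
    (l : 'I_(nsum n) -> R) (mu : R) (edge : rel 'I_(nsum n))
    (C Wc : forall i, 'M[R]_(n i))
    (W : 'M[R]_(nsum n)) (WM : 'M[R]_(nsum n * nsum n)) (beta : R)
    (x eta : nat -> 'cV[R]_(nsum n))
    (psi : nat -> forall i, 'M[R]_(n i))
    (xi : nat -> 'I_(nsum n) -> 'cV[R]_(nsum n))
    (f_convex : forall a, @convex_function R 'cV[R]_(nsum n) setT (f a))
    (f_C1 : forall a, continuously_differentiable (f a))
    (f_lip : forall a, euclidean_lipschitz (l a) (gradient (f a)))
    (mu_gt0 : 0 < mu) (P_mono : strongly_monotone mu (pseudo_gradient f))
    (graph : communication_graph edge)
    (C_weights : forall i, consensus_weights edge (C i))
    (Wc_lyap : forall i, lyapunov_solution (Cbar (C i)) (Wc i))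
    (W_weights : observer_weights edge W)
    (WM_lyap : lyapunov_solution (observer_mx edge W) WM)
    (beta_gt0 : 0 < beta)
    (beta_le : (beta%:E <= step_bound edge l mu C Wc W WM)%E)
    (run : algorithm f res edge C W beta x eta psi xi) :
  (exists xs, unique (nash_equilibrium f res) xs /\ linear_convergence x xs) /\
  (forall i k, \sum_(j < n i) x k (agent i j) 0 = coalition_resource res i).
Proof.
split; last by move=> i k; exact: (decision_feasible n_gt0 graph run).
have f_diff a y : differentiable (f a) y by case: (f_C1 a).
have [xs [fx Sx]] := stationary_exists res n_gt0 f_diff f_lip mu_gt0 P_mono.
exists xs; split.
  exact: (stationary_unique_nash n_gt0 f_convex f_diff mu_gt0 P_mono fx Sx).
exact: (run_linear_convergence N_gt0 n_gt0 f_diff f_lip mu_gt0 P_mono graph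
  C_weights Wc_lyap W_weights WM_lyap beta_gt0 run fx Sx beta_le).
Qed.
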